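(* Let $0<|q|<1$ and $a,b,c,d,e\in\mathbb C^\ast$. Then, whenever the series converge, the following identities hold. (1) $${}_7W_6^1\left(a;b,c,d,e;q,\tfrac{q^2a^2}{bcde}\right)=\frac{(qa,\frac{qa}{de};q)_\infty}{(\frac{qa}{d},\frac{qa}{e};q)_\infty}\,{}_3\phi_2\left(\tfrac{qa}{bc},d,e;\tfrac{qa}{b},\tfrac{qa}{c};q,\tfrac{qa}{de}\right).$$ (2) $${}_6W_5^2\left(a;b,c,d;q,\tfrac{q^2a^2}{bcd}\right)=\frac{(qa;q)_\infty}{(\frac{qa}{d};q)_\infty}\,{}_2\phi_2\left(\tfrac{qa}{bc},d;\tfrac{qa}{b},\tfrac{qa}{c};q,\tfrac{qa}{d}\right)=\frac{(qa,\frac{qa}{bd};q)_\infty}{(\frac{qa}{b},\frac{qa}{d};q)_\infty}\,{}_2\phi_1\left(b,d;\tfrac{qa}{c};q,\tfrac{qa}{bd}\right).$$ (3) $${}_5W_4^3\left(a;b,c;q,\tfrac{q^2a^2}{bc}\right)=(qa;q)_\infty\,{}_1\phi_2\left(\tfrac{qa}{bc};\tfrac{qa}{b},\tfrac{qa}{c};q,qa\right)=\frac{(qa;q)_\infty}{(\frac{qa}{b};q)_\infty}\,{}_1\phi_1\left(b;\tfrac{qa}{c};q,\tfrac{qa}{b}\right)$$ $$=\frac{(qa,\frac{qa}{bc};q)_\infty}{(\frac{qa}{b},\frac{qa}{c};q)_\infty}\,{}_2\phi_1\left(b,c;0;q,\tfrac{qa}{bc}\right)=\frac{(qa,b;q)_\infty}{(\frac{qa}{c};q)_\infty}\,{}_2\phi_1\left(\tfrac{qa}{bc},0;\tfrac{qa}{b};q,b\right).$$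 (4) $${}_4W_3^4\left(a;b;q,\tfrac{q^2a^2}{b}\right)=(qa;q)_\infty\,{}_0\phi_1\left(-;\tfrac{qa}{b};q,qa\right)=\frac{(qa;q)_\infty}{(\frac{qa}{b};q)_\infty}\,{}_1\phi_1\left(b;0;q,\tfrac{qa}{b}\right)=(qa,b;q)_\infty\,{}_2\phi_1\left(0,0;\tfrac{qa}{b};q,b\right).$$ (5) $${}_3W_2^5\left(a;-;q,q^2a^2\right)=(qa;q)_\infty\,{}_0\phi_1\left(-;0;q,qa\right)=(qa,\pm iq\sqrt a;q)_\infty\,{}_2\phi_3\left(0,0;-q,\pm iq\sqrt a;q,qa\right).$$
   Context: $\mathbb C^\ast=\mathbb C\setminus\{0\}$. For $0<|q|<1$: $(x;q)_\infty=\prod_{n\ge0}(1-xq^n)$, $(x;q)_k=(x;q)_\infty/(xq^k;q)_\infty$, and $(x_1,\dots,x_m;q)_k=\prod_i(x_i;q)_k$ for $k\in\mathbb N_0\cup\{\infty\}$. In any list, $\pm x$ stands for the two entries $x,-x$; the symbol $-$ alone denotes an empty list of parameters. Basic hypergeometric series: $${}_r\phi_s(a_1,\dots,a_r;b_1,\dots,b_s;q,z)=\sum_{k=0}^\infty\frac{(a_1,\dots,a_r;q)_k}{(q,b_1,\dots,b_s;q)_k}\left((-1)^kq^{\binom k2}\right)^{s-r+1}z^k,$$ where entries equal to $0$ are allowed and $r,s$ count all entries including zeros. Very-well-poised series with $p\ge 0$ vanishing denominator parameters: $${}_{r+1}W_r^p(a;a_4,\dots,a_{r+1};q,z)=\sum_{k=0}^\infty\frac{1-aq^{2k}}{1-a}\,\frac{(a,a_4,\dots,a_{r+1};q)_k}{(q,\frac{qa}{a_4},\dots,\frac{qa}{a_{r+1}};q)_k}\left((-1)^kq^{\binom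 k2}\right)^{p}z^k$$ (this is the ${}_{r+1}\phi_{r+p}$ series with numerator parameters $a,\pm q\sqrt a,a_4,\dots,a_{r+1}$ and denominator parameters $\pm\sqrt a,\frac{qa}{a_4},\dots,\frac{qa}{a_{r+1}}$ and $p$ zeros). All parameters are assumed to be such that no denominator factor vanishes. *)

(* Defs.v *)
From Stdlib Require Export Reals List.
From Coquelicot Require Export Coquelicot.
Export ListNotations.
Open Scope C_scope.

(** Sum of a complex series: the value is meaningful when
    [ex_series u] holds (see [CSeries_unique]). *)
Definition CSeries (u : nat -> C) : C := 
  iota (T := C_CompleteNormedModule) (fun l : C => is_series u l).

Lemma CSeries_unique (u : nat -> C) (l : C) : is_series u l -> CSeries u = l.
Proof.
exact (iota_filterlim_locally (V := C_CompleteNormedModule) (sum_n u) l).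
Qed.

(** [(x;q)_k] as a finite product.  The quotient [(x;q)_oo / (x q^k;q)_oo] is
    [0/0] when [x q^k] is one of [1, q^-1, q^-2, ...]; whenever it makes sense
    the two agree (see [qpoch_inf_split]). *)
Fixpoint qpoch (q x : C) (k : nat) : C :=
  match k with
  | O => 1
  | S n => qpoch q x n * (1 - x * q ^ n)
  end.

Definition qpoch_inf (q x : C) : C :=
  iota (T := C_CompleteNormedModule)
    (fun l : C => filterlim (qpoch q x) eventually (locally l)).

Lemma qpoch_add (q x : C) (k n : nat) :
  qpoch q x (k + n) = qpoch q x k * qpoch q (x * q ^ k) n.
Proof.
induction n as [|n IH].
- rewrite Nat.add_0_r; simpl; ring.
- rewrite Nat.add_succ_r; simpl; rewrite IH, Cpow_add_r; ring.
Qed.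

Lemma qpoch_inf_split (q x l : C) (k : nat) :
  filterlim (qpoch q (x * q ^ k)) eventually (locally l) ->
  qpoch_inf q x = qpoch q x k * qpoch_inf q (x * q ^ k).
Proof.
intros H.
assert (E : qpoch_inf q (x * q ^ k) = l)
  by exact (iota_filterlim_locally (V := C_CompleteNormedModule) _ l H).
rewrite E.
apply (iota_filterlim_locally (V := C_CompleteNormedModule)).
assert (H' : filterlim (fun n => qpoch q x (k + n)) eventually
               (locally (qpoch q x k * l))).
{ apply filterlim_ext with (fun n => qpoch q x k * qpoch q (x * q ^ k) n).
  - intros n; symmetry; apply qpoch_add.
  - apply (filterlim_comp _ _ _ _ _ _ _ _ H
             (filterlim_scal_r (K := C_AbsRing) (V := C_NormedModule)
                (qpoch q x k) l)). }
intros P HP; destruct (H' P HP) as [N HN]; exists (k + N)%nat; intros n Hn.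
replace n with (k + (n - k))%nat by (rewrite Nat.add_comm; apply Nat.sub_add;
  apply Nat.le_trans with (2 := Hn); apply Nat.le_add_r).
apply HN, Nat.le_add_le_sub_l, Hn.
Qed.

Definition Cprod_list (l : list C) : C := fold_right Cmult 1 l.

Definition qpochs (q : C) (xs : list C) (k : nat) : C :=
  Cprod_list (map (fun x => qpoch q x k) xs).

Definition qpochs_inf (q : C) (xs : list C) : C :=
  Cprod_list (map (qpoch_inf q) xs).

(** No factor [1 - x q^n] of [(x;q)_k] or [(x;q)_oo] vanishes. *)
Definition qpoch_nonvanishing (q x : C) : Prop :=
  forall n : nat, 1 - x * q ^ n <> 0.

(** [(-1)^k q^(k choose 2)] *)
Definition qsign (q : C) (k : nat) : C := (- (1)) ^ k * q ^ (k * (k - 1) / 2).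

(** The exponent [s - r + 1] may be negative, hence the quotient of powers. *)
Definition phi_term (xs ys : list C) (q z : C) (k : nat) : C :=
  qpochs q xs k / qpochs q (q :: ys) k
  * (qsign q k ^ (length ys + 1) / qsign q k ^ length xs) * z ^ k.

Definition phi (xs ys : list C) (q z : C) : C := CSeries (phi_term xs ys q z).

Definition W_term (p : nat) (a : C) (bs : list C) (q z : C) (k : nat) : C :=
  (1 - a * q ^ (2 * k)) / (1 - a)
  * (qpochs q (a :: bs) k / qpochs q (q :: map (fun b => q * a / b) bs) k)
  * qsign q k ^ p * z ^ k.

(** The subscript [r+1] is determined by the list [bs = [a_4; ...; a_(r+1)]]. *)
Definition W (p : nat) (a : C) (bs : list C) (q z : C) : C :=
  CSeries (W_term p a bs q z).

(* Main.v *)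
Require Import Defs.
From Stdlib Require Import Lia Lra.

(** Writing [B = 1/b], ..., [E = 1/e], all identities except the last ones in
    (3), (4) and (5) are instances of (1) in which some of [B], ..., [E] are [0].
    Identity (1) is the limit [N -> oo] of Watson's transformation of a
    terminating very-well-poised series with the extra parameter [q^-N]; the
    latter follows from two applications of the Bailey lemma (hence of the
    q-Saalschuetz sum) to the unit Bailey pair.  Both sides of the finite identity are
    [sum_(k <= N) u_k f(N,k)] with [u_k] the summand of the infinite series and
    [|f(N,k) - f(N,k+1)| <= K |q|^(N-k-1)], so by summation by parts the limit only
    needs the convergence of [sum u_k]; boundary and terminating cases need no
    separate treatment.  The three remaining identities combine this limit with
    finite forms of a Heine transformation and of an identity of Rogers. *)

(** * Finite sums *)

Lemma Cmult_reg_l (x y z : C) : x <> 0 -> x * y = x * z -> y = z.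
Proof.
intros Hx H. replace y with (/ x * (x * y)) by (field; exact Hx).
rewrite H. field. exact Hx.
Qed.

(** The index [n] is excluded, so a sum over k <= N is written [csum u (S N)]. *)
Fixpoint csum (u : nat -> C) (n : nat) : C :=
  match n with
  | O => 0
  | S m => csum u m + u m
  end.

Lemma csum_ext (u v : nat -> C) (n : nat) :
  (forall k, (k < n)%nat -> u k = v k) -> csum u n = csum v n.
Proof.
induction n as [|n IH]; intros H; simpl; [reflexivity|].
rewrite H by lia. rewrite IH; [reflexivity|]. intros k Hk. apply H. lia.
Qed.

Lemma csum_plus (u v : nat -> C) (n : nat) :
  csum (fun k => u k + v k) n = csum u n + csum v n.
Proof. induction n as [|n IH]; simpl; [|rewrite IH]; ring. Qed.

Lemma csum_scal (c : C) (u : nat -> C) (n : nat) :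
  csum (fun k => c * u k) n = c * csum u n.
Proof. induction n as [|n IH]; simpl; [|rewrite IH]; ring. Qed.

Lemma csum_recl (u : nat -> C) (n : nat) :
  csum u (S n) = u O + csum (fun k => u (S k)) n.
Proof.
induction n as [|n IH]; [simpl; ring|].
change (csum u (S n) + u (S n) = u O + csum (fun k => u (S k)) (S n)).
rewrite IH. simpl. ring.
Qed.

(** Both sides run over the triangle k <= j < n, by rows on the left and with j = k + i on the
    right; a new row j = n adds one term to each inner sum. *)
Lemma csum_triangle (f : nat -> nat -> C) (n : nat) :
  csum (fun j => csum (f j) (S j)) n
  = csum (fun k => csum (fun i => f (k + i)%nat k) (n - k)) n.
Proof.
induction n as [|n IH]; [reflexivity|].
change (csum (fun j => csum (f j) (S j)) n + csum (f n) (S n)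
        = csum (fun k => csum (fun i => f (k + i)%nat k) (S n - k)) (S n)).
rewrite IH, (csum_ext (fun k => csum (fun i => f (k + i)%nat k) (S n - k))
               (fun k => csum (fun i => f (k + i)%nat k) (n - k) + f n k)).
- rewrite csum_plus. simpl csum at 4. rewrite Nat.sub_diag. simpl. ring.
- intros k Hk. rewrite Nat.sub_succ_l by lia. simpl.
  replace (k + (n - k))%nat with n by lia. reflexivity.
Qed.

Lemma csum_rev (u : nat -> C) (n : nat) :
  csum u (S n) = csum (fun k => u (n - k)%nat) (S n).
Proof.
induction n as [|n IH]; [reflexivity|].
rewrite (csum_recl (fun k => u (S n - k)%nat)). simpl Nat.sub at 1.
rewrite (csum_ext (fun k => u (S n - S k)%nat) (fun k => u (n - k)%nat))
  by reflexivity.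
rewrite <- IH. change (csum u (S (S n))) with (csum u (S n) + u (S n)). ring.
Qed.

(** The common index set is m + k < n. Grouping by j = m + k reduces both orders of summation to
    [csum_triangle]. *)
Lemma csum_antidiag (f : nat -> nat -> C) (n : nat) :
  csum (fun m => csum (f m) (n - m)) n
  = csum (fun k => csum (fun m => f m k) (n - k)) n.
Proof.
transitivity (csum (fun j => csum (fun k => f (j - k)%nat k) (S j)) n).
- transitivity (csum (fun j => csum (fun m => f m (j - m)%nat) (S j)) n).
  + rewrite (csum_triangle (fun j m => f m (j - m)%nat)).
    apply csum_ext. intros k _. apply csum_ext. intros i _. f_equal. lia.
  + apply csum_ext. intros j _. rewrite csum_rev. apply csum_ext. intros k Hk.
    f_equal. lia.
- rewrite (csum_triangle (fun j k => f (j - k)%nat k)).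
  apply csum_ext. intros k _. apply csum_ext. intros i _. f_equal. lia.
Qed.

(** * Finite identities *)

Lemma qpoch_ext_arg (q x y : C) (k : nat) : x = y -> qpoch q x k = qpoch q y k.
Proof. intros ->. reflexivity. Qed.

Lemma qpoch_recl (q x : C) (k : nat) :
  qpoch q x (S k) = (1 - x) * qpoch q (x * q) k.
Proof.
change (S k) with (1 + k)%nat. rewrite qpoch_add. simpl.
rewrite (qpoch_ext_arg q (x * (q * 1)) (x * q)) by ring. ring.
Qed.

(** [prod_(l < k) (D - y q^l)], so that [(d;q)_k = d^k * rpoch q (1/d) 1 k]
    with a right-hand side that still makes sense for [1/d = 0]. *)
Fixpoint rpoch (q D y : C) (k : nat) : C :=
  match k with
  | O => 1
  | S n => rpoch q D y n * (D - y * q ^ n)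
  end.

Lemma rpoch_add (q D y : C) (k n : nat) :
  rpoch q D y (k + n) = rpoch q D y k * rpoch q D (y * q ^ k) n.
Proof.
induction n as [|n IH].
- rewrite Nat.add_0_r; simpl; ring.
- rewrite Nat.add_succ_r; simpl; rewrite IH, Cpow_add_r; ring.
Qed.

Lemma qpoch_neq_0 (q x : C) (k : nat) :
  qpoch_nonvanishing q x -> qpoch q x k <> 0.
Proof.
intros H; induction k as [|k IH]; simpl.
- exact C1_nz.
- apply Cmult_neq_0; [exact IH|apply H].
Qed.

(* The partial sums telescope: with [x = t D E], the difference of the
   [m+1]-st summand and [(1 - t D z q^m)(1 - t E y q^m)] times the [m]-th one
   is [G (i+1) - G i], where [- G (i+1)] is the last term below. *)
Lemma q_saalschutz_step (q t D E y z : C) (m i : nat) :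
  qpoch_nonvanishing q q -> (i <= m)%nat ->
  let s n k := rpoch q D y k * rpoch q E z k * t ^ k * qpoch q (t * D * E) (n - k)
               * qpoch q (t * y * z * q ^ k) (n - k)
               / (qpoch q q k * qpoch q q (n - k)) in
  (1 - q ^ S m) * csum (s (S m)) (S i)
  = (1 - t * D * z * q ^ m) * (1 - t * E * y * q ^ m) * csum (s m) (S i)
    - q ^ (m - i) * t * (D - y * q ^ i) * (E - z * q ^ i) * s m i.
Proof.
intros Hq Hi s.
induction i as [|i IH].
- simpl. rewrite !Nat.sub_0_r. unfold s. rewrite !Nat.sub_0_r. simpl.
  pose proof (qpoch_neq_0 q q m Hq). specialize (Hq m).
  field. split; auto.
- change (csum (s (S m)) (S (S i))) with (csum (s (S m)) (S i) + s (S m) (S i)).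
  change (csum (s m) (S (S i))) with (csum (s m) (S i) + s m (S i)).
  rewrite Cmult_plus_distr_l, IH by lia. clear IH.
  (* Writing m = i + 1 + j turns every truncated subtraction into [j] or [S j]. *)
  assert (exists j, m = S i + j)%nat as [j ->] by (exists (m - S i)%nat; lia).
  set (X := csum (s (S i + j)%nat) (S i)). clearbody X.
  unfold s; cbv beta.
  replace (S i + j - i)%nat with (S j) by lia.
  replace (S i + j - S i)%nat with j by lia.
  replace (S (S i + j) - S i)%nat with (S j) by lia.
  rewrite (qpoch_recl q (t * y * z * q ^ i) j).
  rewrite (qpoch_ext_arg q (t * y * z * q ^ i * q) (t * y * z * q ^ S i))
    by (simpl; ring).
  pose proof (qpoch_neq_0 q q i Hq). pose proof (qpoch_neq_0 q q j Hq).
  pose proof (Hq i). pose proof (Hq j).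
  simpl. rewrite Cpow_add_r.
  field. repeat split; auto.
Qed.

(** Induction on [m]: at i = m the boundary term of [q_saalschutz_step] is 1 - q^(m+1) times the
    summand of index m + 1 that is missing from the sum on its left. The values 0 of the parameters
    give the degenerate forms of the sum. *)
Lemma q_saalschutz (q t D E y z : C) (m : nat) :
  qpoch_nonvanishing q q ->
  csum (fun i => rpoch q D y i * rpoch q E z i * t ^ i
                 * qpoch q (t * D * E) (m - i)
                 * qpoch q (t * y * z * q ^ i) (m - i)
                 / (qpoch q q i * qpoch q q (m - i))) (S m)
  = qpoch q (t * D * z) m * qpoch q (t * E * y) m / qpoch q q m.
Proof.
intros Hq. induction m as [|m IH].
- simpl. field.
- pose proof (q_saalschutz_step q t D E y z m m Hq (Nat.le_refl m)) as H.
  cbv zeta in H.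
  set (s := fun n k : nat => rpoch q D y k * rpoch q E z k * t ^ k
    * qpoch q (t * D * E) (n - k) * qpoch q (t * y * z * q ^ k) (n - k)
    / (qpoch q q k * qpoch q q (n - k))) in H.
  change (csum (s m) (S m) = qpoch q (t * D * z) m * qpoch q (t * E * y) m
            / qpoch q q m) in IH.
  change (csum (s (S m)) (S m) + s (S m) (S m)
    = qpoch q (t * D * z) (S m) * qpoch q (t * E * y) (S m) / qpoch q q (S m)).
  rewrite IH in H.
  pose proof (qpoch_neq_0 q q m Hq) as Hm. specialize (Hq m).
  assert (Hl : (1 - q * q ^ m) * s (S m) (S m) =
     q ^ (m - m) * t * (D - y * q ^ m) * (E - z * q ^ m) * s m m).
  { unfold s. rewrite !Nat.sub_diag. simpl. field. split; auto. }
  apply (Cmult_reg_l (1 - q * q ^ m)); [exact Hq|].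
  rewrite Cmult_plus_distr_l, Hl. simpl Cpow in H at 1. rewrite H. simpl.
  field. split; auto.
Qed.

(* [T i] plays the role of [1 / (q a; q)_i], which may be infinite. *)
Lemma bailey_lemma (q a D E : C) (T al ga : nat -> C) (N : nat) :
  qpoch_nonvanishing q q ->
  qpoch_nonvanishing q (q * a * D) -> qpoch_nonvanishing q (q * a * E) ->
  (forall i j, (i + j <= 2 * N)%nat ->
     T i = qpoch q (a * q ^ S i) j * T (i + j)%nat) ->
  (forall n, (n <= N)%nat ->
     csum (fun k => al k * T (n + k)%nat / qpoch q q (n - k)) (S n) = ga n) ->
  forall n, (n <= N)%nat ->
  csum (fun k => al k * (rpoch q D 1 k * rpoch q E 1 k * (q * a) ^ k
                 / (qpoch q (q * a * D) k * qpoch q (q * a * E) k))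
                 * T (n + k)%nat / qpoch q q (n - k)) (S n)
  = csum (fun j => rpoch q D 1 j * rpoch q E 1 j * (q * a) ^ j
                   * qpoch q (q * a * D * E) (n - j) / qpoch q q (n - j) * ga j)
      (S n) / (qpoch q (q * a * D) n * qpoch q (q * a * E) n).
Proof.
intros Hq HD HE HT Hp n Hn.
set (t := q * a).
(* Inserting the pair relation for [ga j] gives a double sum over k <= j; after the exchange, the
   inner sum over j = k + i is a q-Saalschuetz sum with y = z = q^k. *)
rewrite (csum_ext (fun j => rpoch q D 1 j * rpoch q E 1 j * t ^ j
            * qpoch q (t * D * E) (n - j) / qpoch q q (n - j) * ga j)
          (fun j => csum (fun k => rpoch q D 1 j * rpoch q E 1 j * t ^ j
            * qpoch q (t * D * E) (n - j) / qpoch q q (n - j)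
            * (al k * T (j + k)%nat / qpoch q q (j - k))) (S j))).
2:{ intros k Hk. rewrite csum_scal, Hp by lia. reflexivity. }
rewrite (csum_triangle (fun j k => rpoch q D 1 j * rpoch q E 1 j * t ^ j
            * qpoch q (t * D * E) (n - j) / qpoch q q (n - j)
            * (al k * T (j + k)%nat / qpoch q q (j - k)))).
match goal with |- _ = ?X / ?Y =>
  change (X / Y) with (X * / Y); rewrite (Cmult_comm X), <- csum_scal
end.
apply csum_ext. intros k Hk.
rewrite Nat.sub_succ_l by lia.
rewrite (csum_ext _ (fun i =>
   (al k * rpoch q D 1 k * rpoch q E 1 k * t ^ k * T (n + k)%nat)
   * (rpoch q D (q ^ k) i * rpoch q E (q ^ k) i * t ^ i
                 * qpoch q (t * D * E) (n - k - i)
                 * qpoch q (t * q ^ k * q ^ k * q ^ i) (n - k - i)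
                 / (qpoch q q i * qpoch q q (n - k - i))))).
- rewrite csum_scal, q_saalschutz by exact Hq.
  assert (Hs : forall x, qpoch q x n = qpoch q x k * qpoch q (x * q ^ k) (n - k)).
  { intros x. rewrite <- qpoch_add. f_equal. lia. }
  assert (HDk := qpoch_neq_0 _ _ n HD). assert (HEk := qpoch_neq_0 _ _ n HE).
  fold t in HDk, HEk. rewrite Hs in HDk, HEk. rewrite !Hs.
  pose proof (qpoch_neq_0 q q (n - k) Hq) as Hm.
  field. repeat split; auto;
   intros Z; first [apply HDk; rewrite Z; ring | apply HEk; rewrite Z; ring].
- intros i Hi. rewrite !rpoch_add.
  (* Passing from [T (j + k)] to [T (n + k)] makes the last factor independent of i and produces the
     factor of base point t q^(2k+i) in the q-Saalschuetz sum. *)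
  rewrite (HT (k + i + k)%nat (n - k - i)%nat) by lia.
  replace (k + i + k + (n - k - i))%nat with (n + k)%nat by lia.
  replace (n - (k + i))%nat with (n - k - i)%nat by lia.
  replace (k + i - k)%nat with i by lia.
  rewrite (qpoch_ext_arg q (t * q ^ k * q ^ k * q ^ i) (a * q ^ S (k + i + k)))
    by (unfold t; simpl; rewrite !Cpow_add_r; ring).
  rewrite Cpow_add_r, Cmult_1_l.
  pose proof (qpoch_neq_0 q q i Hq). pose proof (qpoch_neq_0 q q (n - k - i) Hq).
  field. split; auto.
Qed.

Lemma rpoch_recr (q D y : C) (k : nat) :
  rpoch q D y (S k) = rpoch q D y k * (D - y * q ^ k).
Proof. reflexivity. Qed.

(** * The unit Bailey pair and Watson's finite transformation *)

(** The alpha sequence of the unit Bailey pair relative to [a]; the factor [rpoch q 0 1 k] is (-1)^k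
    q^(k choose 2). *)
Definition unit_alpha (q a : C) (k : nat) : C :=
  (1 - a * q ^ (2 * k)) / (1 - a) * (qpoch q a k / qpoch q q k) * rpoch q 0 1 k.

Lemma unit_bailey_pair (q a : C) (T : nat -> C) (N : nat) :
  qpoch_nonvanishing q q -> 1 - a <> 0 ->
  (forall i j, (i + j <= 2 * N)%nat ->
     T i = qpoch q (a * q ^ S i) j * T (i + j)%nat) ->
  forall n, (n <= N)%nat ->
  csum (fun k => unit_alpha q a k * T (n + k)%nat / qpoch q q (n - k)) (S n)
  = if Nat.eqb n 0 then T O else 0.
Proof.
intros Hq Ha HT n Hn.
destruct n as [|n].
- simpl. unfold unit_alpha. simpl. field. exact Ha.
- assert (Hqa : forall k, qpoch q a (S k) = (1 - a) * qpoch q (a * q) k)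
    by (intros; apply qpoch_recl).
  assert (HT1 : forall i, (i < 2 * N)%nat ->
             T i = (1 - a * q ^ S i) * T (S i)).
  { intros i Hi. rewrite (HT i 1%nat) by lia. rewrite Nat.add_1_r. simpl. ring. }
  (* The partial sums have a product form; at K = n it is minus the one remaining summand, so the
     whole sum vanishes. *)
  assert (Htel : forall K, (K <= n)%nat ->
    csum (fun k => unit_alpha q a k * T (S n + k)%nat / qpoch q q (S n - k)) (S K)
    = qpoch q (a * q) K * rpoch q 0 1 K * q ^ K * T (S n + K)%nat
      / (qpoch q q K * qpoch q q (n - K) * (1 - q ^ S n))).
  { induction K as [|K IH]; intros HK.
    - simpl. rewrite Nat.add_0_r, Nat.sub_0_r. unfold unit_alpha. simpl.
      pose proof (qpoch_neq_0 q q n Hq). specialize (Hq n). field. repeat split; auto.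
    - change (csum (fun k => unit_alpha q a k * T (S n + k)%nat / qpoch q q (S n - k)) (S K)
        + unit_alpha q a (S K) * T (S n + S K)%nat / qpoch q q (S n - S K)
        = qpoch q (a * q) (S K) * rpoch q 0 1 (S K) * q ^ (S K) * T (S n + S K)%nat
      / (qpoch q q (S K) * qpoch q q (n - S K) * (1 - q ^ S n))).
      rewrite IH by lia. clear IH. unfold unit_alpha. rewrite Hqa, HT1 by lia.
      replace (S (S n + K))%nat with (S n + S K)%nat by lia.
      assert (exists j, n = S K + j)%nat as [j ->] by (exists (n - S K)%nat; lia).
      replace (S K + j - K)%nat with (S j) by lia.
      replace (S (S K + j) - S K)%nat with (S j) by lia.
      replace (S K + j - S K)%nat with j by lia.
      replace (2 * S K)%nat with (2 + K + K)%nat by lia.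
      pose proof (qpoch_neq_0 q q K Hq). pose proof (qpoch_neq_0 q q j Hq).
      pose proof (Hq K). pose proof (Hq j). pose proof (Hq (S K + j)%nat) as Hj.
      set (T0 := T (S (S K + j) + S K)%nat). simpl. simpl in Hj.
      rewrite ?Cpow_add_r in *. simpl in *. rewrite ?Cpow_add_r in *.
      field. repeat split; auto. }
  change (csum (fun k => unit_alpha q a k * T (S n + k)%nat / qpoch q q (S n - k)) (S n)
     + unit_alpha q a (S n) * T (S n + S n)%nat / qpoch q q (S n - S n) = 0).
  rewrite Htel by lia. unfold unit_alpha. rewrite !Nat.sub_diag, Hqa.
  rewrite HT1 by lia. replace (S (S n + n)) with (S n + S n)%nat by lia.
  replace (2 * S n)%nat with (2 + n + n)%nat by lia.
  pose proof (qpoch_neq_0 q q n Hq). pose proof (Hq n).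
  set (T0 := T (S n + S n)%nat). simpl. rewrite ?Cpow_add_r. simpl.
  rewrite ?Cpow_add_r. field. repeat split; auto.
Qed.

(** For t = q a and B = 1/b, ..., E = 1/e this is the summand of the 3phi2: the powers d^k e^k taken
    out of (d,e;q)_k cancel against z^k. *)
Definition phi_limit_term (q t B G D E : C) (k : nat) : C :=
  rpoch q D 1 k * rpoch q E 1 k * t ^ k
  * (qpoch q (t * B * G) k
     / (qpoch q q k * (qpoch q (t * B) k * qpoch q (t * G) k))).

(** The unit pair multiplied by the factors of two Bailey steps. A parameter set to 0 contributes
    one more sign factor [rpoch q 0 1 k] and a denominator 1, which is how the exponent [p] of
    [W_term] grows from 1 to 5. *)
Definition W_limit_term (q a B G D E : C) (k : nat) : C :=
  let t := q * a in
  unit_alpha q a k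
  * (rpoch q B 1 k * rpoch q G 1 k * t ^ k / (qpoch q (t * B) k * qpoch q (t * G) k))
  * (rpoch q D 1 k * rpoch q E 1 k * t ^ k / (qpoch q (t * D) k * qpoch q (t * E) k)).

Lemma watson_finite (q a B G D E : C) (N : nat) :
  1 - a <> 0 -> qpoch_nonvanishing q q ->
  qpoch_nonvanishing q (q * a * B) -> qpoch_nonvanishing q (q * a * G) ->
  qpoch_nonvanishing q (q * a * D) -> qpoch_nonvanishing q (q * a * E) ->
  csum (fun k => W_limit_term q a B G D E k
                 * (qpoch q (a * q ^ S (N + k)) (N - k) / qpoch q q (N - k))) (S N)
  = qpoch q (q * a) (N + N) / (qpoch q (q * a * D) N * qpoch q (q * a * E) N)
    * csum (fun k => phi_limit_term q (q * a) B G D E k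
                     * (qpoch q (q * a * D * E) (N - k) / qpoch q q (N - k))) (S N).
Proof.
intros Ha Hq HB HC HD HE.
(* This is (qa;q)_(2N) / (qa;q)_i after cancellation, which stays meaningful when some factor of
   (qa;q)_(2N) is 0. *)
set (T := fun i => qpoch q (a * q ^ S i) (N + N - i)).
assert (HT : forall i j, (i + j <= 2 * N)%nat ->
     T i = qpoch q (a * q ^ S i) j * T (i + j)%nat).
{ intros i j Hij. unfold T. replace (N + N - i)%nat with (j + (N + N - (i + j)))%nat by lia.
  rewrite qpoch_add. f_equal. apply qpoch_ext_arg. simpl. rewrite Cpow_add_r. ring. }
pose proof (bailey_lemma q a D E T _ _ N Hq HD HE HT
  (bailey_lemma q a B G T _ _ N Hq HB HC HT
     (unit_bailey_pair q a T N Hq Ha HT)) N (Nat.le_refl N)) as H.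
rewrite (csum_ext _ (fun k => unit_alpha q a k *
          (rpoch q B 1 k * rpoch q G 1 k * (q * a) ^ k /
           (qpoch q (q * a * B) k * qpoch q (q * a * G) k)) *
          (rpoch q D 1 k * rpoch q E 1 k * (q * a) ^ k /
           (qpoch q (q * a * D) k * qpoch q (q * a * E) k)) *
          T (N + k)%nat / qpoch q q (N - k))).
2:{ intros k Hk. unfold W_limit_term, T. replace (N + N - (N + k))%nat with (N - k)%nat by lia.
    unfold Cdiv. ring. }
rewrite H. match goal with |- ?X / ?Y = ?Z =>
  change (X * / Y = Z); rewrite (Cmult_comm X), <- !csum_scal
end.
apply csum_ext. intros k Hk.
(* In the inner sum the unit pair leaves only j = 0, where [T 0] is (qa;q)_(2N); the other terms are
   written [0 * 0] so that [csum_scal] extracts a factor 0. *)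
rewrite csum_recl, (csum_ext _ (fun j => 0 * 0)), csum_scal.
- unfold phi_limit_term. simpl Nat.eqb. cbv iota. rewrite Nat.sub_0_r.
  replace (T O) with (qpoch q (q * a) (N + N)).
  2:{ unfold T. rewrite Nat.sub_0_r. apply qpoch_ext_arg. simpl. ring. }
  pose proof (qpoch_neq_0 _ _ k HB). pose proof (qpoch_neq_0 _ _ k HC).
  pose proof (qpoch_neq_0 _ _ N HD). pose proof (qpoch_neq_0 _ _ N HE).
  pose proof (qpoch_neq_0 _ _ k Hq). pose proof (qpoch_neq_0 _ _ (N - k) Hq).
  simpl. field. repeat split; auto.
- intros j Hj. simpl. ring.
Qed.

(** * Finite forms of the Heine and Rogers identities *)

Lemma rpoch_1 (q x : C) (k : nat) : rpoch q 1 x k = qpoch q x k.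
Proof. induction k as [|k IH]; simpl; [|rewrite IH]; reflexivity. Qed.

Lemma rpoch_y_0 (q D : C) (k : nat) : rpoch q D 0 k = D ^ k.
Proof. induction k as [|k IH]; simpl; [|rewrite IH]; ring. Qed.

Lemma rpoch_D_0 (q y : C) (k : nat) : rpoch q 0 y k = y ^ k * rpoch q 0 1 k.
Proof. induction k as [|k IH]; simpl; [|rewrite IH]; ring. Qed.

Lemma qpoch_0 (q : C) (k : nat) : qpoch q 0 k = 1.
Proof. induction k as [|k IH]; simpl; [|rewrite IH]; ring. Qed.

(** The case t = D = 1, E = z, y = h of [q_saalschutz], with the parameter named [z] there equal to
    0. *)
Lemma q_chu_vandermonde (q h z : C) (m : nat) :
  qpoch_nonvanishing q q ->
  csum (fun i => qpoch q h i * z ^ i * qpoch q z (m - i)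
                 / (qpoch q q i * qpoch q q (m - i))) (S m)
  = qpoch q (h * z) m / qpoch q q m.
Proof.
intros Hq. rewrite (qpoch_ext_arg q (h * z) (1 * z * h)) by ring.
transitivity (qpoch q (1 * 1 * 0) m * qpoch q (1 * z * h) m / qpoch q q m).
- rewrite <- q_saalschutz by exact Hq. apply csum_ext. intros k Hk.
  rewrite rpoch_1, rpoch_y_0, Cpow_1_l.
  rewrite (qpoch_ext_arg q (1 * h * 0 * q ^ k) 0), qpoch_0 by ring.
  rewrite (qpoch_ext_arg q (1 * 1 * z) z) by ring. unfold Cdiv. ring.
- rewrite (qpoch_ext_arg q (1 * 1 * 0) 0), qpoch_0 by ring. unfold Cdiv. ring.
Qed.

(** The case t = y = 1, D = z = 0, E = u of [q_saalschutz]. *)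
Lemma q_binomial_finite (q u : C) (m : nat) :
  qpoch_nonvanishing q q ->
  csum (fun i => rpoch q 0 1 i * u ^ i / (qpoch q q i * qpoch q q (m - i))) (S m)
  = qpoch q u m / qpoch q q m.
Proof.
intros Hq.
transitivity (qpoch q (1 * 0 * 0) m * qpoch q (1 * u * 1) m / qpoch q q m).
- rewrite <- q_saalschutz by exact Hq. apply csum_ext. intros k Hk.
  rewrite rpoch_y_0, Cpow_1_l.
  rewrite (qpoch_ext_arg q (1 * 1 * 0 * q ^ k) 0), qpoch_0 by ring.
  rewrite (qpoch_ext_arg q (1 * 0 * u) 0), qpoch_0 by ring. unfold Cdiv. ring.
- rewrite (qpoch_ext_arg q (1 * 0 * 0) 0), qpoch_0 by ring.
  rewrite (qpoch_ext_arg q (1 * u * 1) u) by ring. unfold Cdiv. ring.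
Qed.

(** Heine's argument at finite [N]: expand (u q^m;q)_(N-m) by the q-binomial theorem, exchange the
    sums, and evaluate the sum over m by q-Chu-Vandermonde with z = b q^k. *)
Lemma heine_finite (q h b u : C) (N : nat) :
  qpoch_nonvanishing q q ->
  csum (fun m => qpoch q h m * b ^ m * qpoch q b (N - m) * qpoch q (u * q ^ m) (N - m)
                 / (qpoch q q m * qpoch q q (N - m))) (S N)
  = csum (fun k => rpoch q 0 1 k * u ^ k * qpoch q b k * qpoch q (h * b * q ^ k) (N - k)
                   / (qpoch q q k * qpoch q q (N - k))) (S N).
Proof.
intros Hq.
set (f := fun m k => qpoch q h m * (b * q ^ k) ^ m * qpoch q (b * q ^ k) (N - k - m)
      * (rpoch q 0 1 k * u ^ k * qpoch q b k)
      / (qpoch q q m * qpoch q q k * qpoch q q (N - k - m))).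
transitivity (csum (fun m => csum (fun k => f m k) (S N - m)) (S N)).
- apply csum_ext. intros m Hm. rewrite Nat.sub_succ_l by lia.
  transitivity (qpoch q h m * b ^ m * qpoch q b (N - m) / qpoch q q m
     * (qpoch q (u * q ^ m) (N - m) / qpoch q q (N - m))).
  { pose proof (qpoch_neq_0 _ _ m Hq). pose proof (qpoch_neq_0 _ _ (N - m) Hq).
    field. split; auto. }
  rewrite <- q_binomial_finite, <- csum_scal by exact Hq.
  apply csum_ext. intros k Hk. unfold f.
  replace (qpoch q b (N - m)) with (qpoch q b k * qpoch q (b * q ^ k) (N - k - m)).
  2:{ rewrite <- qpoch_add. f_equal. lia. }
  replace (N - m - k)%nat with (N - k - m)%nat by lia.
  rewrite !Cpow_mult_l, <- !Cpow_mult_r, (Nat.mul_comm m k).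
  pose proof (qpoch_neq_0 _ _ m Hq). pose proof (qpoch_neq_0 _ _ k Hq).
  pose proof (qpoch_neq_0 _ _ (N - k - m) Hq). field. repeat split; auto.
- rewrite csum_antidiag.
  apply csum_ext. intros k Hk. rewrite Nat.sub_succ_l by lia.
  transitivity (rpoch q 0 1 k * u ^ k * qpoch q b k / qpoch q q k
     * (qpoch q (h * (b * q ^ k)) (N - k) / qpoch q q (N - k))).
  + rewrite <- q_chu_vandermonde, <- csum_scal by exact Hq.
    apply csum_ext. intros m Hm. unfold f.
    pose proof (qpoch_neq_0 _ _ m Hq). pose proof (qpoch_neq_0 _ _ k Hq).
    pose proof (qpoch_neq_0 _ _ (N - k - m) Hq). field. repeat split; auto.
  + rewrite (qpoch_ext_arg q (h * (b * q ^ k)) (h * b * q ^ k)) by ring.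
    pose proof (qpoch_neq_0 _ _ k Hq). pose proof (qpoch_neq_0 _ _ (N - k) Hq).
    field. split; auto.
Qed.

(** Comparison of the coefficients of x^n in 1/(x;q)_oo = 1/(x;q^2)_oo * 1/(xq;q^2)_oo, by Euler's
    expansion of each factor. The proof is by a recurrence in [n]. *)
Lemma rogers_coefficient (q : C) (n : nat) :
  qpoch_nonvanishing q q -> qpoch_nonvanishing (q ^ 2) (q ^ 2) ->
  csum (fun j => q ^ (n - j) / (qpoch (q ^ 2) (q ^ 2) j * qpoch (q ^ 2) (q ^ 2) (n - j)))
    (S n) = / qpoch q q n.
Proof.
intros Hq HQ. set (A := fun m => csum (fun j => q ^ (m - j)
  / (qpoch (q ^ 2) (q ^ 2) j * qpoch (q ^ 2) (q ^ 2) (m - j))) (S m)).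
change (A n = / qpoch q q n).
induction n as [|n IH].
- unfold A. simpl. field.
- assert (Hr : A (S n) = csum (fun j => q ^ j
    / (qpoch (q ^ 2) (q ^ 2) j * qpoch (q ^ 2) (q ^ 2) (S n - j))) (S (S n))).
  { unfold A. rewrite csum_rev. apply csum_ext. intros k Hk.
    replace (S n - (S n - k))%nat with k by lia. f_equal. ring. }
  (* Subtracting q^(n+1) times the reversed sum gives the j-th summand the numerator q^(n+1-j) (1 -
     q^(2j)); it vanishes at j = 0 and otherwise cancels the last factor of (q^2;q^2)_j. *)
  assert (Hs : A (S n) = q ^ S n * A (S n) + A n).
  { rewrite Hr at 2. unfold A at 1. rewrite <- csum_scal.
    rewrite !(csum_recl _ (S n)), !Nat.sub_0_r. unfold A.
    rewrite <- Cplus_assoc, <- csum_plus. f_equal.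
    - pose proof (qpoch_neq_0 _ _ (S n) HQ) as Hd. revert Hd.
      generalize (qpoch (q ^ 2) (q ^ 2) (S n)). intros d Hd. simpl. field. exact Hd.
    - apply csum_ext. intros j Hj.
      replace (S n - S j)%nat with (n - j)%nat by lia.
      pose proof (qpoch_neq_0 _ _ j HQ) as Hj'. pose proof (qpoch_neq_0 _ _ (n - j) HQ) as Hn'.
      specialize (HQ j).
      assert (E : q ^ S n = q ^ (n - j) * q * q ^ j).
      { replace (S n) with (S (n - j) + j)%nat by lia. rewrite Cpow_add_r. simpl. ring. }
      rewrite E. change (qpoch (q ^ 2) (q ^ 2) (S j))
        with (qpoch (q ^ 2) (q ^ 2) j * (1 - q ^ 2 * (q ^ 2) ^ j)).
      assert (E2 : q ^ 2 * (q ^ 2) ^ j = q ^ S j * q ^ S j).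
      { rewrite <- Cpow_mult_r, <- !Cpow_add_r. f_equal. lia. }
      rewrite E2 in *. simpl Cpow at 6. simpl Cpow in *.
      field. repeat split; auto. }
  rewrite IH in Hs.
  pose proof (qpoch_neq_0 _ _ n Hq). pose proof (Hq n).
  apply (Cmult_reg_l (1 - q * q ^ n)); [assumption|].
  transitivity (A (S n) - q ^ S n * A (S n)); [simpl; ring|].
  rewrite Hs at 1. simpl. field. split; auto.
Qed.

(** Expand 1/(q;q)_n by [rogers_coefficient], exchange the sums, and evaluate the inner sum by the
    q-binomial theorem in base q^2. Here [rpoch (q ^ 2) 0 1 n * (- q * a) ^ n] is q^(n^2) a^n. *)
Lemma rogers_finite (q a : C) (N : nat) :
  qpoch_nonvanishing q q -> qpoch_nonvanishing (q ^ 2) (q ^ 2) ->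
  csum (fun n => rpoch (q ^ 2) 0 1 n * (- q * a) ^ n
                 / (qpoch q q n * qpoch (q ^ 2) (q ^ 2) (N - n))) (S N)
  = csum (fun k => rpoch (q ^ 2) 0 1 k * (- q * a) ^ k
       * qpoch (q ^ 2) (- q ^ 2 * a * (q ^ 2) ^ k) (N - k)
       / (qpoch (q ^ 2) (q ^ 2) k * qpoch (q ^ 2) (q ^ 2) (N - k))) (S N).
Proof.
intros Hq HQ. set (Q := q ^ 2) in *.
set (f := fun n k => rpoch Q 0 1 n * (- q * a) ^ n / qpoch Q Q (N - n)
            * (q ^ (n - k) / (qpoch Q Q k * qpoch Q Q (n - k)))).
transitivity (csum (fun n => csum (f n) (S n)) (S N)).
- apply csum_ext. intros n Hn. unfold f. rewrite csum_scal.
  pose proof (rogers_coefficient q n Hq HQ) as Hc. fold Q in Hc. rewrite Hc.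
  pose proof (qpoch_neq_0 _ _ n Hq). pose proof (qpoch_neq_0 _ _ (N - n) HQ).
  field. split; auto.
- rewrite csum_triangle. apply csum_ext. intros k Hk. rewrite Nat.sub_succ_l by lia.
  transitivity (rpoch Q 0 1 k * (- q * a) ^ k / qpoch Q Q k
     * (qpoch Q (- Q * a * Q ^ k) (N - k) / qpoch Q Q (N - k))).
  + rewrite <- q_binomial_finite, <- csum_scal by assumption.
    apply csum_ext. intros i Hi. unfold f.
    rewrite rpoch_add, Cmult_1_l, (rpoch_D_0 Q (Q ^ k)).
    replace (N - (k + i))%nat with (N - k - i)%nat by lia.
    replace (k + i - k)%nat with i by lia.
    replace (- Q * a * Q ^ k) with (q * (- q * a) * Q ^ k) by (unfold Q; ring).
    rewrite !Cpow_mult_l, !Cpow_add_r.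
    pose proof (qpoch_neq_0 _ _ k HQ). pose proof (qpoch_neq_0 _ _ i HQ).
    pose proof (qpoch_neq_0 _ _ (N - k - i) HQ). field. repeat split; auto.
  + pose proof (qpoch_neq_0 _ _ k HQ). pose proof (qpoch_neq_0 _ _ (N - k) HQ).
    field. split; auto.
Qed.

(** * Limits *)

Definition Clim (u : nat -> C) (l : C) : Prop :=
  filterlim u eventually (locally (T := C_UniformSpace) l).

Lemma Clim_Cmod (u : nat -> C) (l : C) :
  is_lim_seq (fun n => Cmod (u n - l)) 0 <-> Clim u l.
Proof.
unfold Clim.
pose proof (filterlim_locally_ball_norm (K := C_AbsRing) (U := C_NormedModule)
  (F := eventually) u l) as HB. split; intros H.
- apply HB. intros eps. apply is_lim_seq_spec in H.
  destruct (H eps) as [N HN]. exists N. intros n Hn. specialize (HN n Hn).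
  rewrite Rminus_0_r, Rabs_pos_eq in HN by apply Cmod_ge_0. exact HN.
- apply is_lim_seq_spec. intros eps. destruct (proj1 HB H eps) as [N HN].
  exists N. intros n Hn. rewrite Rminus_0_r, Rabs_pos_eq by apply Cmod_ge_0.
  exact (HN n Hn).
Qed.

Lemma Clim_unique (u : nat -> C) (l m : C) : Clim u l -> Clim u m -> l = m.
Proof.
apply (filterlim_locally_unique (K := C_AbsRing) (V := C_NormedModule)).
Qed.

Lemma Clim_ext (u v : nat -> C) (l : C) :
  (forall n, u n = v n) -> Clim u l -> Clim v l.
Proof. intros H. apply filterlim_ext. exact H. Qed.

Lemma Clim_const (c : C) : Clim (fun _ => c) c.
Proof. apply filterlim_const. Qed.

Lemma Clim_mult (u v : nat -> C) (l m : C) :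
  Clim u l -> Clim v m -> Clim (fun n => u n * v n) (l * m).
Proof.
intros Hu Hv. apply Clim_Cmod in Hu. apply Clim_Cmod in Hv. apply Clim_Cmod.
apply is_lim_seq_le_le with (u := fun _ => 0%R)
  (w := fun n => (Cmod (u n - l) * Cmod (v n - m)
                  + (Cmod l * Cmod (v n - m) + Cmod m * Cmod (u n - l)))%R).
- intros n. split; [apply Cmod_ge_0|].
  replace (u n * v n - l * m)
    with ((u n - l) * (v n - m) + (l * (v n - m) + m * (u n - l))) by ring.
  rewrite <- !Cmod_mult. eapply Rle_trans; [apply Cmod_triangle|].
  apply Rplus_le_compat_l, Cmod_triangle.
- apply is_lim_seq_const.
- replace (Finite 0) with (Finite (0 * 0 + (Cmod l * 0 + Cmod m * 0))%R)
    by (f_equal; ring).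
  apply is_lim_seq_plus'; [apply is_lim_seq_mult'; assumption|].
  apply is_lim_seq_plus'; apply is_lim_seq_mult'; try assumption;
    apply is_lim_seq_const.
Qed.

Lemma Clim_subseq (u : nat -> C) (l : C) (phi : nat -> nat) :
  (forall n, (n <= phi n)%nat) -> Clim u l -> Clim (fun n => u (phi n)) l.
Proof.
intros Hphi H P HP. destruct (H P HP) as [N HN]. exists N. intros n Hn.
apply HN. specialize (Hphi n). lia.
Qed.

Lemma Clim_unshift (u : nat -> C) (l : C) : Clim (fun n => u (S n)) l -> Clim u l.
Proof.
intros H P HP. destruct (H P HP) as [N HN]. exists (S N). intros n Hn.
destruct n as [|n]; [lia|]. apply HN. lia.
Qed.

Lemma csum_sum_n (u : nat -> C) (n : nat) :
  csum u (S n) = sum_n (G := C_AbelianMonoid) u n.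
Proof.
induction n as [|n IH].
- rewrite sum_O. simpl. ring.
- rewrite sum_Sn, <- IH. reflexivity.
Qed.

Lemma Clim_csum_CSeries (u : nat -> C) : ex_series u -> Clim (csum u) (CSeries u).
Proof.
(* [sum_n] includes its upper index and [csum] does not, hence the shift by one. *)
intros [l Hl]. rewrite (CSeries_unique u l Hl). apply Clim_unshift.
apply (Clim_ext (sum_n (G := C_AbelianMonoid) u)); [|exact Hl].
intros n. symmetry. apply csum_sum_n.
Qed.

(* [sum_(k < n) e_k r^(n-1-k)] *)
Fixpoint geom_conv (r : R) (e : nat -> R) (n : nat) : R :=
  match n with
  | O => 0%R
  | S m => (r * geom_conv r e m + e m)%R
  end.

Open Scope R_scope.

(** Once [e] is small, the old contributions decay like r^m, while the new ones add up to at most a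
    geometric series. *)
Lemma geom_conv_lim (r : R) (e : nat -> R) :
  0 <= r < 1 -> (forall n, 0 <= e n) -> is_lim_seq e 0 -> is_lim_seq (geom_conv r e) 0.
Proof.
intros Hr He Hlim.
assert (Hpos : forall n, 0 <= geom_conv r e n).
{ induction n as [|n IH]; simpl; [lra|]. specialize (He n).
  apply Rplus_le_le_0_compat; [apply Rmult_le_pos|]; lra. }
apply is_lim_seq_spec. intros eps. apply is_lim_seq_spec in Hlim.
(* With this threshold, eps/2 is the fixed point of x -> r x + threshold, so it survives the
   induction in [Hm]. *)
assert (Hd : 0 < eps / 2 * (1 - r)).
{ apply Rmult_lt_0_compat; [|lra]. pose proof (cond_pos eps); lra. }
destruct (Hlim (mkposreal _ Hd)) as [N HN]. simpl in HN.
assert (Hm : forall m, geom_conv r e (N + m) <= r ^ m * geom_conv r e N + eps / 2).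
{ induction m as [|m IH].
  - rewrite Nat.add_0_r. simpl. pose proof (cond_pos eps). lra.
  - rewrite Nat.add_succ_r. simpl.
    specialize (HN (N + m)%nat (Nat.le_add_r N m)).
    rewrite Rminus_0_r, Rabs_pos_eq in HN by apply He.
    specialize (He (N + m)%nat).
    assert (r * geom_conv r e (N + m) + e (N + m)%nat
            <= r * (r ^ m * geom_conv r e N + eps / 2) + eps / 2 * (1 - r)) by nra.
    lra. }
assert (Hg : is_lim_seq (fun m => r ^ m * geom_conv r e N) 0).
{ replace (Finite 0) with (Rbar_mult (Finite 0) (Finite (geom_conv r e N)))
    by (simpl; f_equal; ring).
  apply is_lim_seq_mult'; [|apply is_lim_seq_const].
  apply is_lim_seq_geom. rewrite Rabs_pos_eq; lra. }
apply is_lim_seq_spec in Hg.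
destruct (Hg (pos_div_2 eps)) as [M HM]. simpl in HM.
exists (N + M)%nat. intros n Hn.
specialize (HM (n - N)%nat ltac:(lia)). specialize (Hm (n - N)%nat).
replace (N + (n - N))%nat with n in Hm by lia.
rewrite Rminus_0_r in *. rewrite Rabs_pos_eq by apply Hpos.
apply Rabs_def2 in HM. lra.
Qed.

(* Summation by parts; no absolute convergence of [u] is needed. *)
Lemma toeplitz (u : nat -> C) (s L : C) (f : nat -> nat -> C) (K r : R) :
  0 <= r < 1 -> Clim (csum u) s ->
  (forall N k, (k < N)%nat -> Cmod (f N k - f N (S k))%C <= K * r ^ (N - S k)) ->
  (forall N, Cmod (f N N) <= K) ->
  Clim (fun N => f N O) L ->
  Clim (fun N => csum (fun k => u k * f N k)%C (S N)) (s * L)%C.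
Proof.
intros Hr Hu Hf HN HL.
set (e := fun k => Cmod (csum u (S k) - s)%C).
assert (He : is_lim_seq e 0).
{ apply (is_lim_seq_incr_1 (fun k => Cmod (csum u k - s)%C)). apply Clim_Cmod, Hu. }
assert (Hep : forall n, 0 <= e n) by (intros; apply Cmod_ge_0).
assert (HK : 0 <= K).
{ apply Rle_trans with (2 := HN O). apply Cmod_ge_0. }
(* Abel summation centred at the limit [s]: only the errors of the partial sums multiply the
   increments of [g]. *)
assert (Habel : forall (g : nat -> C) n,
  (csum (fun k => u k * g k) (S n)
  = s * g O + (csum u (S n) - s) * g n
    + csum (fun k => (csum u (S k) - s) * (g k - g (S k))) n)%C).
{ intros g n. induction n as [|n IH]; [simpl; ring|].
  change (csum (fun k => u k * g k) (S n) + u (S n) * g (S n)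
   = s * g O + (csum u (S n) + u (S n) - s) * g (S n)
     + (csum (fun k => (csum u (S k) - s) * (g k - g (S k))) n
        + (csum u (S n) - s) * (g n - g (S n))))%C.
  rewrite IH. ring. }
(* The geometric bound on the increments of [f N] turns the Abel sum into the convolution of [e]
   with powers of [r], which tends to 0. *)
assert (Hb : forall N n, (n <= N)%nat ->
  Cmod (csum (fun k => (csum u (S k) - s) * (f N k - f N (S k)))%C n)
  <= K * (r ^ (N - n) * geom_conv r e n)).
{ intros N n. induction n as [|n IH]; intros Hn.
  - simpl. rewrite Cmod_0. lra.
  - match goal with |- Cmod (csum ?F _) <= _ =>
      change (csum F (S n)) with (csum F n + F n)%C
    end.
    eapply Rle_trans; [apply Cmod_triangle|].
    specialize (IH ltac:(lia)). rewrite Cmod_mult. specialize (Hf N n Hn).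
    fold (e n).
    simpl geom_conv. replace (N - n)%nat with (S (N - S n)) in IH by lia.
    simpl pow in *. specialize (Hep n). set (p := r ^ (N - S n)) in *.
    assert (e n * Cmod (f N n - f N (S n))%C <= e n * (K * p))
      by (apply Rmult_le_compat_l; assumption).
    lra. }
apply Clim_Cmod.
apply is_lim_seq_le_le with (u := fun _ => 0)
  (w := fun N => K * (geom_conv r e N + e N) + Cmod s * Cmod (f N O - L)%C).
- intros N. split; [apply Cmod_ge_0|].
  rewrite Habel.
  replace (s * f N O + (csum u (S N) - s) * f N N
    + csum (fun k => (csum u (S k) - s) * (f N k - f N (S k))) N - s * L)%C
   with (csum (fun k => (csum u (S k) - s) * (f N k - f N (S k))) N
     + (csum u (S N) - s) * f N N + s * (f N O - L))%C by ring.
  eapply Rle_trans; [apply Cmod_triangle|]. rewrite Cmod_mult.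
  apply Rplus_le_compat_r.
  eapply Rle_trans; [apply Cmod_triangle|]. rewrite Cmod_mult. fold (e N).
  specialize (Hb N N (Nat.le_refl N)). rewrite Nat.sub_diag in Hb.
  specialize (HN N). specialize (Hep N).
  assert (e N * Cmod (f N N) <= e N * K) by (apply Rmult_le_compat_l; assumption).
  simpl pow in Hb. lra.
- apply is_lim_seq_const.
- replace (Finite 0) with (Finite (K * (0 + 0) + Cmod s * 0)) by (f_equal; ring).
  apply is_lim_seq_plus'.
  + apply is_lim_seq_mult'; [apply is_lim_seq_const|].
    apply is_lim_seq_plus'; [apply geom_conv_lim|]; assumption.
  + apply is_lim_seq_mult'; [apply is_lim_seq_const|].
    apply Clim_Cmod, HL.
Qed.

(** * Uniform bounds and limits of shifted factorials *)

(** Each factor satisfies |1 - x q^k| <= 1 + |x| |q|^k <= exp(|x| |q|^k), and the exponents sum to a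
    geometric series. *)
Lemma qpoch_le (q x : C) (k : nat) :
  Cmod q < 1 -> Cmod (qpoch q x k) <= exp (Cmod x / (1 - Cmod q)).
Proof.
intros Hq. pose proof (Cmod_ge_0 q). pose proof (Cmod_ge_0 x).
assert (H1 : Cmod (qpoch q x k) <= exp (Cmod x * (1 - Cmod q ^ k) / (1 - Cmod q))).
{ induction k as [|k IH].
  - simpl. rewrite Cmod_1. replace (Cmod x * (1 - 1) / (1 - Cmod q)) with 0
      by (field; lra). rewrite exp_0. lra.
  - simpl qpoch. rewrite Cmod_mult.
    replace (Cmod x * (1 - Cmod q ^ S k) / (1 - Cmod q))
      with (Cmod x * (1 - Cmod q ^ k) / (1 - Cmod q) + Cmod x * Cmod q ^ k)
      by (simpl; field; lra).
    rewrite exp_plus. apply Rmult_le_compat; try apply Cmod_ge_0; [exact IH|].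
    apply Rle_trans with (1 + Cmod x * Cmod q ^ k).
    + unfold Cminus. eapply Rle_trans; [apply Cmod_triangle|].
      rewrite Cmod_1, Cmod_opp, Cmod_mult, Cmod_pow. lra.
    + apply exp_ineq1_le. }
eapply Rle_trans; [exact H1|].
assert (Cmod x * (1 - Cmod q ^ k) / (1 - Cmod q) <= Cmod x / (1 - Cmod q)) as [Hlt| ->].
{ unfold Rdiv. apply Rmult_le_compat_r.
  - left. apply Rinv_0_lt_compat. lra.
  - pose proof (pow_le (Cmod q) k H). nra. }
- left. apply exp_increasing, Hlt.
- lra.
Qed.

(** The increments - (x;q)_k x q^k are bounded through [qpoch_le] and summed geometrically. *)
Lemma qpoch_sub_1_le (q x : C) (k : nat) :
  Cmod q < 1 ->
  Cmod (qpoch q x k - 1)%C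
  <= exp (Cmod x / (1 - Cmod q)) * (Cmod x / (1 - Cmod q)).
Proof.
intros Hq. pose proof (Cmod_ge_0 q). pose proof (Cmod_ge_0 x).
set (M := exp (Cmod x / (1 - Cmod q))).
assert (HM : 0 < M) by apply exp_pos.
assert (H1 : Cmod (qpoch q x k - 1)%C <= M * (Cmod x * (1 - Cmod q ^ k) / (1 - Cmod q))).
{ induction k as [|k IH].
  - simpl. replace (1 - 1)%C with (RtoC 0) by ring. rewrite Cmod_0.
    replace (M * (Cmod x * (1 - 1) / (1 - Cmod q))) with 0 by (field; lra). lra.
  - simpl qpoch. replace (qpoch q x k * (1 - x * q ^ k) - 1)%C
      with (qpoch q x k - 1 + - (qpoch q x k * (x * q ^ k)))%C by ring.
    eapply Rle_trans; [apply Cmod_triangle|].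
    rewrite Cmod_opp, !Cmod_mult, Cmod_pow.
    replace (M * (Cmod x * (1 - Cmod q ^ S k) / (1 - Cmod q)))
      with (M * (Cmod x * (1 - Cmod q ^ k) / (1 - Cmod q)) + M * (Cmod x * Cmod q ^ k))
      by (simpl; field; lra).
    apply Rplus_le_compat; [exact IH|]. apply Rmult_le_compat_r.
    + apply Rmult_le_pos; [assumption|apply pow_le; assumption].
    + apply qpoch_le, Hq. }
eapply Rle_trans; [exact H1|]. apply Rmult_le_compat_l; [lra|].
unfold Rdiv. apply Rmult_le_compat_r.
- left. apply Rinv_0_lt_compat. lra.
- pose proof (pow_le (Cmod q) k H). nra.
Qed.

Lemma Cpow_lim_0 (q : C) : Cmod q < 1 -> is_lim_seq (fun n => Cmod (q ^ n)%C) 0.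
Proof.
intros Hq. apply is_lim_seq_ext with (fun n => Cmod q ^ n).
- intros n. symmetry. apply Cmod_pow.
- apply is_lim_seq_geom. rewrite Rabs_pos_eq; [exact Hq|apply Cmod_ge_0].
Qed.

(** The previous bound at x q^n, with the exponential estimated by its value at [x]: tails approach
    1 uniformly in their length. *)
Lemma qpoch_tail_sub_1_le (q x : C) (n k : nat) :
  Cmod q < 1 ->
  Cmod (qpoch q (x * q ^ n)%C k - 1)%C
  <= exp (Cmod x / (1 - Cmod q)) * (Cmod x / (1 - Cmod q)) * Cmod (q ^ n)%C.
Proof.
intros Hq. pose proof (Cmod_ge_0 x). pose proof (Cmod_ge_0 q).
assert (Hx : Cmod (x * q ^ n)%C / (1 - Cmod q) <= Cmod x / (1 - Cmod q)).
{ unfold Rdiv. apply Rmult_le_compat_r; [left; apply Rinv_0_lt_compat; lra|].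
  rewrite Cmod_mult, Cmod_pow.
  assert (Cmod q ^ n <= 1) by (rewrite <- (pow1 n); apply pow_incr; lra).
  pose proof (pow_le (Cmod q) n H0). nra. }
eapply Rle_trans; [apply qpoch_sub_1_le, Hq|].
rewrite Rmult_assoc. apply Rmult_le_compat.
- left. apply exp_pos.
- apply Rmult_le_pos; [apply Cmod_ge_0|left; apply Rinv_0_lt_compat; lra].
- destruct Hx as [Hx| ->]; [left; apply exp_increasing, Hx|lra].
- rewrite Cmod_mult. right. field. lra.
Qed.

Lemma qpoch_tail_bound_lim_0 (q x : C) :
  Cmod q < 1 ->
  is_lim_seq (fun n => exp (Cmod x / (1 - Cmod q)) * (Cmod x / (1 - Cmod q))
                       * Cmod (q ^ n)%C) 0.
Proof.
intros Hq.
replace (Finite 0) with (Finite (exp (Cmod x / (1 - Cmod q)) * (Cmod x / (1 - Cmod q)) * 0))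
  by (f_equal; ring).
apply is_lim_seq_mult'; [apply is_lim_seq_const|apply Cpow_lim_0, Hq].
Qed.

Lemma qpoch_tail_lim_1 (q x : C) (f : nat -> nat) :
  Cmod q < 1 -> Clim (fun n => qpoch q (x * q ^ n)%C (f n)) 1.
Proof.
intros Hq. apply Clim_Cmod.
eapply is_lim_seq_le_le with (u := fun _ => 0);
  [|apply is_lim_seq_const|apply (qpoch_tail_bound_lim_0 q x Hq)].
intros n. split; [apply Cmod_ge_0|apply qpoch_tail_sub_1_le, Hq].
Qed.

(** A uniform lower bound that controls denominators and keeps the infinite product away from 0.
    From some [K] on the tail is within 1/2 of 1; a shorter product divides (x;q)_K with a bounded
    cofactor. *)
Lemma qpoch_ge (q x : C) :
  Cmod q < 1 -> qpoch_nonvanishing q x ->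
  exists c, 0 < c /\ forall k, c <= Cmod (qpoch q x k).
Proof.
intros Hq Hx.
assert (HK : exists K, forall k, / 2 <= Cmod (qpoch q (x * q ^ K)%C k)).
{ pose proof (qpoch_tail_bound_lim_0 q x Hq) as H. apply is_lim_seq_spec in H.
  destruct (H (mkposreal (/ 2) ltac:(lra))) as [K HK]. exists K. intros k.
  specialize (HK K (Nat.le_refl K)). simpl in HK.
  rewrite Rminus_0_r in HK. apply Rabs_def2 in HK.
  pose proof (qpoch_tail_sub_1_le q x K k Hq) as Hk.
  pose proof (Cmod_triangle (qpoch q (x * q ^ K)%C k) (- (qpoch q (x * q ^ K)%C k - 1))%C)
    as Ht.
  replace (qpoch q (x * q ^ K) k + - (qpoch q (x * q ^ K) k - 1))%C with (RtoC 1)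
    in Ht by ring.
  rewrite Cmod_1, Cmod_opp in Ht. lra. }
destruct HK as [K HK].
assert (Hpos : 0 < Cmod (qpoch q x K)) by (apply Cmod_gt_0, qpoch_neq_0, Hx).
set (M := exp (Cmod x / (1 - Cmod q))).
assert (HM : 1 <= M).
{ unfold M. apply Rle_trans with (exp 0); [rewrite exp_0; lra|].
  assert (0 <= Cmod x / (1 - Cmod q)) as [H| <-].
  - apply Rmult_le_pos; [apply Cmod_ge_0|left; apply Rinv_0_lt_compat; lra].
  - left. apply exp_increasing, H.
  - lra. }
(* One constant for both cases: k >= K needs the 2 together with M >= 1, and k < K needs [M] as the
   bound of the cofactor. *)
exists (Cmod (qpoch q x K) / (2 * M)). split.
- apply Rmult_lt_0_compat; [exact Hpos|apply Rinv_0_lt_compat; lra].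
- intros k. apply (Rmult_le_reg_r (2 * M)); [lra|].
  unfold Rdiv. rewrite Rmult_assoc, Rinv_l, Rmult_1_r by lra.
  destruct (Nat.le_gt_cases K k) as [Hk|Hk].
  + replace k with (K + (k - K))%nat by lia. rewrite qpoch_add, Cmod_mult.
    specialize (HK (k - K)%nat). rewrite Rmult_assoc.
    rewrite <- (Rmult_1_r (Cmod (qpoch q x K))) at 1.
    apply Rmult_le_compat_l; [lra|]. nra.
  + replace (qpoch q x K) with (qpoch q x k * qpoch q (x * q ^ k) (K - k))%C
      by (rewrite <- qpoch_add; f_equal; lia).
    rewrite Cmod_mult. apply Rmult_le_compat_l; [apply Cmod_ge_0|].
    apply Rle_trans with M; [|lra].
    eapply Rle_trans; [apply qpoch_le, Hq|]. unfold M.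
    assert (Cmod (x * q ^ k)%C / (1 - Cmod q) <= Cmod x / (1 - Cmod q)) as [H| ->].
    * unfold Rdiv. apply Rmult_le_compat_r; [left; apply Rinv_0_lt_compat; lra|].
      rewrite Cmod_mult, Cmod_pow. pose proof (Cmod_ge_0 q). pose proof (Cmod_ge_0 x).
      assert (Cmod q ^ k <= 1) by (rewrite <- (pow1 k); apply pow_incr; lra). nra.
    * left. apply exp_increasing, H.
    * lra.
Qed.

Lemma qpoch_nonvanishing_small (q x : C) :
  Cmod q < 1 -> Cmod x < 1 -> qpoch_nonvanishing q x.
Proof.
intros Hq Hx n Hn. pose proof (Cmod_ge_0 q). pose proof (Cmod_ge_0 x).
assert (E : (x * q ^ n)%C = 1%C).
{ replace (x * q ^ n)%C with (1 - (1 - x * q ^ n))%C by ring. rewrite Hn. ring. }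
apply (f_equal Cmod) in E. rewrite Cmod_mult, Cmod_pow, Cmod_1 in E.
assert (Cmod q ^ n <= 1) by (rewrite <- (pow1 n); apply pow_incr; lra).
pose proof (pow_le (Cmod q) n H). nra.
Qed.

(** The products are 1 plus the partial sums of their increments [d], and that series converges
    absolutely. *)
Lemma qpoch_lim (q x : C) : Cmod q < 1 -> Clim (qpoch q x) (qpoch_inf q x).
Proof.
intros Hq. pose proof (Cmod_ge_0 q). pose proof (Cmod_ge_0 x).
set (d := fun n => (- (qpoch q x n * x * q ^ n))%C).
assert (Hex : ex_series (V := C_CompleteNormedModule) d).
{ apply (ex_series_le (K := C_AbsRing) (V := C_CompleteNormedModule) d
    (fun n => Cmod q ^ n * (exp (Cmod x / (1 - Cmod q)) * Cmod x))).
  - intros n. change (Cmod (d n) <= Cmod q ^ n * (exp (Cmod x / (1 - Cmod q)) * Cmod x)).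
    unfold d. rewrite Cmod_opp, !Cmod_mult, Cmod_pow, (Rmult_comm (Cmod q ^ n)).
    apply Rmult_le_compat_r; [apply pow_le; assumption|].
    apply Rmult_le_compat_r; [assumption|]. apply qpoch_le, Hq.
  - apply ex_series_scal_r, ex_series_geom. rewrite Rabs_pos_eq; assumption. }
apply Clim_csum_CSeries in Hex.
assert (Hl : Clim (qpoch q x) (1 + CSeries d)%C).
{ apply Clim_Cmod. apply Clim_Cmod in Hex. revert Hex. apply is_lim_seq_ext.
  intros n. apply (f_equal Cmod). transitivity (1 + csum d n - (1 + CSeries d))%C; [ring|]. f_equal.
  induction n as [|n IH]; simpl; [ring|].
  rewrite Cplus_assoc, IH. unfold d. ring. }
replace (qpoch_inf q x) with (1 + CSeries d)%C; [exact Hl|].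
symmetry. exact (iota_filterlim_locally (V := C_CompleteNormedModule) _ _ Hl).
Qed.

Lemma qpoch_inf_neq_0 (q x : C) :
  Cmod q < 1 -> qpoch_nonvanishing q x -> qpoch_inf q x <> 0%C.
Proof.
intros Hq Hx H0. destruct (qpoch_ge q x Hq Hx) as [c [Hc Hk]].
pose proof (qpoch_lim q x Hq) as H. rewrite H0 in H.
apply Clim_Cmod, is_lim_seq_spec in H. destruct (H (mkposreal c Hc)) as [N HN].
specialize (HN N (Nat.le_refl N)). specialize (Hk N). simpl in HN.
rewrite Rminus_0_r, Rabs_pos_eq in HN by apply Cmod_ge_0.
replace (qpoch q x N - 0)%C with (qpoch q x N) in HN by ring. lra.
Qed.

Lemma qpoch_inf_0 (q : C) : Cmod q < 1 -> qpoch_inf q 0 = 1%C.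
Proof.
intros Hq. apply (Clim_unique (qpoch q 0)); [apply qpoch_lim, Hq|].
apply (Clim_ext (fun _ => RtoC 1)); [|apply Clim_const].
intros n. symmetry. apply qpoch_0.
Qed.

Lemma Cmod_bound_div (x y : C) (M c : R) :
  0 < c -> c <= Cmod y -> Cmod x <= M -> Cmod (x / y)%C <= M / c.
Proof.
intros Hc Hy Hx. assert (y <> 0%C).
{ intros ->. rewrite Cmod_0 in Hy. lra. }
rewrite Cmod_div by assumption. pose proof (Cmod_ge_0 x). unfold Rdiv.
apply Rmult_le_compat; try lra.
- left. apply Rinv_0_lt_compat. lra.
- apply Rinv_le_contravar; assumption.
Qed.

(** * Passage to the limit in the finite transformations *)

(** [toeplitz] for the weights of the finite sums. With j = N - k - 1 the difference of consecutive
    weights is (q;q)_N (x;q)_j (q - x) q^j / (q;q)_(j+1), and the weight at k = 0 is (x;q)_N. *)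
Lemma phi_sums_lim (q x : C) (u : nat -> C) (s : C) :
  Cmod q < 1 -> Clim (csum u) s ->
  Clim (fun N => csum (fun k => u k * (qpoch q q N *
           (qpoch q x (N - k) / qpoch q q (N - k))))%C (S N)) (s * qpoch_inf q x)%C.
Proof.
intros Hq Hu.
pose proof (qpoch_nonvanishing_small q q Hq Hq) as Hqq.
destruct (qpoch_ge q q Hq Hqq) as [c [Hc Hck]].
set (M := exp (Cmod q / (1 - Cmod q))). set (Mx := exp (Cmod x / (1 - Cmod q))).
assert (HM : forall k, Cmod (qpoch q q k) <= M) by (intros; apply qpoch_le, Hq).
assert (HMx : forall k, Cmod (qpoch q x k) <= Mx) by (intros; apply qpoch_le, Hq).
assert (0 < M) by apply exp_pos. assert (0 < Mx) by apply exp_pos.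
assert (0 < / c) by (apply Rinv_0_lt_compat; lra).
assert (HK0 : 0 <= M * (Mx / c))
  by (apply Rmult_le_pos; [lra|]; apply Rmult_le_pos; lra).
pose proof (Cmod_ge_0 (q - x)) as Hqx. pose proof (Cmod_ge_0 q) as Hq0.
assert (HK1 : 0 <= M * (Mx * Cmod (q - x) / c)).
{ apply Rmult_le_pos; [lra|]. apply Rmult_le_pos; [|lra]. apply Rmult_le_pos; lra. }
apply (toeplitz u s _ (fun N k => qpoch q q N * (qpoch q x (N - k) / qpoch q q (N - k)))%C
   (M * (Mx / c) + M * (Mx * Cmod (q - x) / c)) (Cmod q)).
- split; [exact Hq0|exact Hq].
- exact Hu.
- intros N k Hk. replace (N - k)%nat with (S (N - S k)) by lia.
  set (j := (N - S k)%nat).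
  replace (qpoch q q N * (qpoch q x (S j) / qpoch q q (S j))
           - qpoch q q N * (qpoch q x j / qpoch q q j))%C
    with (qpoch q q N * (qpoch q x j * (q - x) / qpoch q q (S j)) * q ^ j)%C.
  2:{ pose proof (qpoch_neq_0 _ _ j Hqq). specialize (Hqq j). simpl.
      field. split; assumption. }
  rewrite !Cmod_mult, Cmod_pow. apply Rmult_le_compat_r; [apply pow_le, Hq0|].
  apply Rle_trans with (M * (Mx * Cmod (q - x) / c)); [|lra].
  apply Rmult_le_compat; try apply Cmod_ge_0; [apply HM|].
  apply Cmod_bound_div; [exact Hc|apply Hck|].
  rewrite Cmod_mult. apply Rmult_le_compat_r; [exact Hqx|apply HMx].
- intros N. rewrite Nat.sub_diag.
  apply Rle_trans with (M * (Mx / c)); [|lra].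
  rewrite Cmod_mult.
  apply Rmult_le_compat; try apply Cmod_ge_0; [apply HM|].
  apply Cmod_bound_div; [exact Hc|apply Hck|apply HMx].
- apply (Clim_ext (qpoch q x)); [|apply qpoch_lim, Hq].
  intros N. rewrite Nat.sub_0_r. field. apply qpoch_neq_0, Hqq.
Qed.

(** As for [phi_sums_lim], but the weight at k = 0 is (a q^(N+1);q)_N, which tends to 1. *)
Lemma W_sums_lim (q a : C) (u : nat -> C) (s : C) :
  Cmod q < 1 -> Clim (csum u) s ->
  Clim (fun N => csum (fun k => u k * (qpoch q q N *
           (qpoch q (a * q ^ S (N + k)) (N - k) / qpoch q q (N - k))))%C (S N)) s.
Proof.
intros Hq Hu.
pose proof (qpoch_nonvanishing_small q q Hq Hq) as Hqq.
destruct (qpoch_ge q q Hq Hqq) as [c [Hc Hck]].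
set (M := exp (Cmod q / (1 - Cmod q))). set (Ma := exp (Cmod a / (1 - Cmod q))).
pose proof (Cmod_ge_0 a) as Ha0. pose proof (Cmod_ge_0 q) as Hq0.
assert (Hpow : forall j, Cmod q ^ j <= 1).
{ intros j. rewrite <- (pow1 j). apply pow_incr; lra. }
assert (HM : forall k, Cmod (qpoch q q k) <= M) by (intros; apply qpoch_le, Hq).
assert (HMa : forall j k, Cmod (qpoch q (a * q ^ j)%C k) <= Ma).
{ intros j k. eapply Rle_trans; [apply qpoch_le, Hq|].
  assert (Cmod (a * q ^ j)%C / (1 - Cmod q) <= Cmod a / (1 - Cmod q)) as [H| H].
  - unfold Rdiv. apply Rmult_le_compat_r; [left; apply Rinv_0_lt_compat; lra|].
    rewrite Cmod_mult, Cmod_pow. specialize (Hpow j). nra.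
  - left. apply exp_increasing, H.
  - rewrite H. apply Rle_refl. }
assert (0 < M) by apply exp_pos. assert (0 < Ma) by apply exp_pos.
assert (0 < / c) by (apply Rinv_0_lt_compat; lra).
assert (HK0 : 0 <= M * (Ma / c))
  by (apply Rmult_le_pos; [lra|]; apply Rmult_le_pos; lra).
assert (HK1 : 0 <= M * (Ma * (1 + Cmod a) / c)).
{ apply Rmult_le_pos; [lra|]. apply Rmult_le_pos; [|lra]. apply Rmult_le_pos; lra. }
replace s with (s * 1)%C by ring.
apply (toeplitz u s _
   (fun N k => qpoch q q N * (qpoch q (a * q ^ S (N + k)) (N - k) / qpoch q q (N - k)))%C
   (M * (Ma / c) + M * (Ma * (1 + Cmod a) / c)) (Cmod q)).
- split; [exact Hq0|exact Hq].
- exact Hu.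
- intros N k Hk. replace (N - k)%nat with (S (N - S k)) by lia.
  assert (HN : N = (S k + (N - S k))%nat) by lia. revert HN.
  generalize (N - S k)%nat. intros j HN.
  rewrite qpoch_recl.
  rewrite (qpoch_ext_arg q (a * q ^ S (N + k) * q) (a * q ^ S (N + S k)))
    by (rewrite Nat.add_succ_r; simpl; ring).
  replace (qpoch q q N * ((1 - a * q ^ S (N + k)) * qpoch q (a * q ^ S (N + S k)) j
             / qpoch q q (S j))
           - qpoch q q N * (qpoch q (a * q ^ S (N + S k)) j / qpoch q q j))%C
    with (qpoch q q N * (qpoch q (a * q ^ S (N + S k)) j * (q + - (a * q ^ (2 * S k)))
            / qpoch q q (S j)) * q ^ j)%C.
  (* Since N + k + 1 = 2(k+1) + j, the power q^j factors out of q^(j+1) - a q^(N+k+1). *)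
  2:{ pose proof (qpoch_neq_0 _ _ j Hqq). specialize (Hqq j).
      replace (a * q ^ S (N + k))%C with (a * q ^ (2 * S k) * q ^ j)%C.
      2:{ rewrite HN, <- Cmult_assoc, <- Cpow_add_r. do 2 f_equal. lia. }
      simpl. field. split; assumption. }
  rewrite !Cmod_mult, Cmod_pow. apply Rmult_le_compat_r; [apply pow_le, Hq0|].
  apply Rle_trans with (M * (Ma * (1 + Cmod a) / c)); [|lra].
  apply Rmult_le_compat; try apply Cmod_ge_0; [apply HM|].
  apply Cmod_bound_div; [exact Hc|apply Hck|].
  rewrite Cmod_mult. apply Rmult_le_compat; try apply Cmod_ge_0; [apply HMa|].
  eapply Rle_trans; [apply Cmod_triangle|]. rewrite Cmod_opp, Cmod_mult, Cmod_pow.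
  specialize (Hpow (2 * S k)%nat). nra.
- intros N. rewrite Nat.sub_diag.
  apply Rle_trans with (M * (Ma / c)); [|lra].
  rewrite Cmod_mult.
  apply Rmult_le_compat; try apply Cmod_ge_0; [apply HM|].
  apply Cmod_bound_div; [exact Hc|apply Hck|apply HMa].
- apply (Clim_ext (fun N => qpoch q (a * q * q ^ N)%C N)).
  + intros N. rewrite Nat.sub_0_r, Nat.add_0_r.
    rewrite (qpoch_ext_arg q (a * q * q ^ N) (a * q ^ S N)) by (simpl; ring).
    field. apply qpoch_neq_0, Hqq.
  + apply (qpoch_tail_lim_1 q (a * q)%C (fun N => N) Hq).
Qed.

(* The parameters stand for [1/b], [1/c], [1/d], [1/e]; the value [0] covers
   the limits in which a parameter of the series tends to infinity. *)
Lemma watson_sums_lim (q a B G D E w : C) :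
  Cmod q < 1 -> (1 - a)%C <> 0%C ->
  qpoch_nonvanishing q (q * a * B) -> qpoch_nonvanishing q (q * a * G) ->
  qpoch_nonvanishing q (q * a * D) -> qpoch_nonvanishing q (q * a * E) ->
  Clim (csum (W_limit_term q a B G D E)) w ->
  Clim (fun N => qpoch q (q * a) (N + N)
          * csum (fun k => phi_limit_term q (q * a) B G D E k * (qpoch q q N *
              (qpoch q (q * a * D * E) (N - k) / qpoch q q (N - k)))) (S N))%C
    (qpoch_inf q (q * a * D) * qpoch_inf q (q * a * E) * w)%C.
Proof.
intros Hq Ha HB HG HD HE Hw.
pose proof (qpoch_nonvanishing_small q q Hq Hq) as Hqq.
(* The sequence is [watson_finite] multiplied by (q;q)_N (qaD;q)_N (qaE;q)_N; its limit is read off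
   the very-well-poised side. *)
eapply Clim_ext; [|apply Clim_mult;
   [apply Clim_mult; apply qpoch_lim, Hq | apply (W_sums_lim q a _ w Hq Hw)]].
intros N. cbv beta.
rewrite (csum_ext _ (fun k => qpoch q q N * (W_limit_term q a B G D E k
   * (qpoch q (a * q ^ S (N + k)) (N - k) / qpoch q q (N - k))))%C)
  by (intros; ring).
rewrite csum_scal, watson_finite by assumption.
rewrite (csum_ext (fun k => phi_limit_term q (q * a) B G D E k * (qpoch q q N *
              (qpoch q (q * a * D * E) (N - k) / qpoch q q (N - k))))%C
  (fun k => qpoch q q N * (phi_limit_term q (q * a) B G D E k *
              (qpoch q (q * a * D * E) (N - k) / qpoch q q (N - k))))%C)
  by (intros; ring).
rewrite csum_scal.
pose proof (qpoch_neq_0 _ _ N HD). pose proof (qpoch_neq_0 _ _ N HE).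
field. split; assumption.
Qed.

(** The sequence of [watson_sums_lim] also converges by its other expression, through [phi_sums_lim]
    and the subsequence (qa;q)_(2N); the two limits agree. *)
Lemma watson_limit (q a B G D E w p : C) :
  Cmod q < 1 -> (1 - a)%C <> 0%C ->
  qpoch_nonvanishing q (q * a * B) -> qpoch_nonvanishing q (q * a * G) ->
  qpoch_nonvanishing q (q * a * D) -> qpoch_nonvanishing q (q * a * E) ->
  Clim (csum (W_limit_term q a B G D E)) w ->
  Clim (csum (phi_limit_term q (q * a) B G D E)) p ->
  w = (qpoch_inf q (q * a) * qpoch_inf q (q * a * D * E)
       / (qpoch_inf q (q * a * D) * qpoch_inf q (q * a * E)) * p)%C.
Proof.
intros Hq Ha HB HG HD HE Hw Hp.
pose proof (watson_sums_lim q a B G D E w Hq Ha HB HG HD HE Hw) as H1.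
pose proof (Clim_mult _ _ _ _
  (Clim_subseq _ _ (fun N => N + N)%nat (fun N => Nat.le_add_r N N)
     (qpoch_lim q (q * a)%C Hq))
  (phi_sums_lim q (q * a * D * E)%C _ p Hq Hp)) as H2.
pose proof (Clim_unique _ _ _ H1 H2) as H3.
pose proof (qpoch_inf_neq_0 _ _ Hq HD). pose proof (qpoch_inf_neq_0 _ _ Hq HE).
apply (Cmult_reg_l (qpoch_inf q (q * a * D) * qpoch_inf q (q * a * E))).
- apply Cmult_neq_0; assumption.
- rewrite H3. field. split; assumption.
Qed.

Lemma nonvanishing_0 (q t : C) : qpoch_nonvanishing q (t * 0)%C.
Proof.
intros n H. apply C1_nz. rewrite <- H. ring.
Qed.

Lemma qpoch_rpoch (q b : C) (k : nat) :
  b <> 0%C -> qpoch q b k = (b ^ k * rpoch q (/ b) 1 k)%C.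
Proof.
intros hb. induction k as [|k IH]; simpl; [ring|]. rewrite IH. field. exact hb.
Qed.

(** Heine's transformation is applied to the finite sums, so that only the very-well-poised series
    and the series in powers of [b] pass to the limit. *)
Lemma watson_heine_limit (q a b G w p : C) :
  Cmod q < 1 -> (1 - a)%C <> 0%C -> b <> 0%C ->
  qpoch_nonvanishing q (q * a * / b) -> qpoch_nonvanishing q (q * a * G) ->
  Clim (csum (W_limit_term q a G 0 (/ b) 0)) w ->
  Clim (csum (fun k => qpoch q (q * a * / b * G) k
                 / (qpoch q q k * qpoch q (q * a * / b) k) * b ^ k)%C) p ->
  w = (qpoch_inf q (q * a) * qpoch_inf q b / qpoch_inf q (q * a * G) * p)%C.
Proof.
intros Hq Ha hb HB HG Hw Hp.
pose proof (qpoch_nonvanishing_small q q Hq Hq) as Hqq.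
pose proof (Clim_mult _ _ _ _ (qpoch_lim q (q * a * G)%C Hq)
  (watson_sums_lim q a G 0 (/ b) 0 w Hq Ha HG (nonvanishing_0 q _)
     HB (nonvanishing_0 q _) Hw)) as H1.
pose proof (Clim_mult _ _ _ _
  (Clim_mult _ _ _ _ (qpoch_lim q (q * a * / b)%C Hq)
    (Clim_subseq _ _ (fun N => N + N)%nat (fun N => Nat.le_add_r N N)
     (qpoch_lim q (q * a)%C Hq)))
  (phi_sums_lim q b _ p Hq Hp)) as H2.
cbv beta in H1, H2.
eapply Clim_ext in H1; [pose proof (Clim_unique _ _ _ H1 H2) as H3|].
- pose proof (qpoch_inf_neq_0 _ _ Hq HB). pose proof (qpoch_inf_neq_0 _ _ Hq HG).
  apply (Cmult_reg_l (qpoch_inf q (q * a * G) * (qpoch_inf q (q * a * / b)))).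
  + apply Cmult_neq_0; assumption.
  + rewrite (Cmult_comm (q * a) 0), Cmult_0_l, qpoch_inf_0 in H3 by assumption.
    transitivity (qpoch_inf q (q * a * G) * (qpoch_inf q (q * a * / b) * 1 * w))%C;
      [ring|]. rewrite H3. field. assumption.
- intros N. cbv beta.
  set (u := (q * a * / b)%C) in *. set (h := (u * G)%C) in *.
  (* This identifies (h b q^k;q)_(N-k) in [heine_finite] with the quotient (qaG;q)_N / (qaG;q)_k. *)
  assert (Ehb : (q * a * G = h * b)%C) by (unfold h, u; field; assumption).
  assert (HN : forall y n k, (k < S n)%nat ->
            qpoch q y n = (qpoch q y k * qpoch q (y * q ^ k) (n - k))%C).
  { intros y n k Hk. rewrite <- qpoch_add. f_equal. lia. }
  transitivity (qpoch q (q * a) (N + N) * qpoch q q N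
    * csum (fun k => rpoch q 0 1 k * u ^ k * qpoch q b k * qpoch q (h * b * q ^ k) (N - k)
                   / (qpoch q q k * qpoch q q (N - k))) (S N))%C.
  + match goal with |- (?X * (?Y * ?Z) = _ * ?V * ?T)%C =>
      transitivity (Y * (X * Z))%C; [ring|]; transitivity (Y * (V * T))%C; [|ring]
    end.
    f_equal. rewrite <- !csum_scal.
    apply csum_ext. intros k Hk.
    unfold phi_limit_term.
    rewrite (qpoch_ext_arg q (q * a * / b * 0) 0), (qpoch_ext_arg q (q * a * 0) 0),
      (qpoch_ext_arg q (q * a * G * 0) 0), !qpoch_0 by ring.
    rewrite (HN _ N k Hk).
    pose proof (qpoch_neq_0 _ _ k HG). pose proof (qpoch_neq_0 _ _ k Hqq).
    pose proof (qpoch_neq_0 _ _ (N - k) Hqq).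
    rewrite <- Ehb.
    replace (rpoch q 0 1 k * u ^ k * qpoch q b k)%C
      with (rpoch q 0 1 k * (rpoch q (/ b) 1 k * (q * a) ^ k))%C.
    2:{ rewrite (qpoch_rpoch q b k hb). unfold u. rewrite !Cpow_mult_l, Cpow_inv by exact hb.
        field. apply Cpow_nz, hb. }
    field. repeat split; assumption.
  + rewrite <- heine_finite by assumption.
    match goal with |- (?X * ?Y * ?Z = ?U * ?V * ?T)%C =>
      transitivity (X * (Y * Z))%C; [ring|]; transitivity (X * (U * T))%C; [|ring]
    end.
    f_equal. rewrite <- !csum_scal. apply csum_ext. intros k Hk.
    rewrite (HN u N k Hk).
    pose proof (qpoch_neq_0 _ _ k HB). pose proof (qpoch_neq_0 _ _ k Hqq).
    pose proof (qpoch_neq_0 _ _ (N - k) Hqq).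
    field. repeat split; assumption.
Qed.

Open Scope C_scope.

(** * Sign factors and the passage to base q^2 *)

Lemma rpoch_0_neq_0 (q : C) (k : nat) : q <> 0 -> rpoch q 0 1 k <> 0.
Proof.
intros q0. induction k as [|k IH]; simpl; [exact C1_nz|].
apply Cmult_neq_0; [exact IH|]. intros H. apply (Cpow_nz q k q0).
replace (q ^ k) with (- (0 - 1 * q ^ k)) by ring. rewrite H. ring.
Qed.

Lemma qsign_rpoch (q : C) (k : nat) : qsign q k = rpoch q 0 1 k.
Proof.
unfold qsign. induction k as [|k IH]; [simpl; ring|].
rewrite rpoch_recr, <- IH.
replace (S k * (S k - 1) / 2)%nat with (k + k * (k - 1) / 2)%nat.
- rewrite Cpow_add_r. simpl. ring.
- rewrite <- Nat.div_add_l by lia. f_equal. destruct k; simpl; lia.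
Qed.

(** Both sides are q^(k(k-1)); this matches the base q^2 summands of Rogers' identity with squared
    sign factors in base q. *)
Lemma rpoch_0_square (q : C) (k : nat) :
  rpoch (q ^ 2) 0 1 k * (- (1)) ^ k = rpoch q 0 1 k * rpoch q 0 1 k.
Proof.
induction k as [|k IH]; [simpl; ring|].
rewrite !rpoch_recr, (Cpow_S (- (1))).
transitivity (rpoch (q ^ 2) 0 1 k * (- (1)) ^ k * (q ^ 2) ^ k); [ring|].
rewrite IH, <- Cpow_mult_r. replace (2 * k)%nat with (k + k)%nat by lia.
rewrite Cpow_add_r. ring.
Qed.

(** Factorwise (1 - y)(1 + y) = 1 - y^2 with y = x q^l: a parameter pair x, -x becomes one parameter
    in base q^2. *)
Lemma qpoch_square (q x : C) (k : nat) :
  qpoch q x k * qpoch q (- x) k = qpoch (q ^ 2) (x ^ 2) k.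
Proof.
induction k as [|k IH]; [simpl; ring|].
change (qpoch q x k * (1 - x * q ^ k) * (qpoch q (- x) k * (1 - - x * q ^ k))
        = qpoch (q ^ 2) (x ^ 2) k * (1 - x ^ 2 * (q ^ 2) ^ k)).
rewrite <- IH, <- Cpow_mult_r.
replace (2 * k)%nat with (k + k)%nat by lia. rewrite Cpow_add_r. simpl. ring.
Qed.

Lemma Cmod_pow_2_lt_1 (q : C) : (Cmod q < 1)%R -> (Cmod (q ^ 2) < 1)%R.
Proof. intros H. rewrite Cmod_pow. pose proof (Cmod_ge_0 q). simpl. nra. Qed.

Lemma nonvanishing_square (q x : C) :
  qpoch_nonvanishing q x -> qpoch_nonvanishing q (- x) ->
  qpoch_nonvanishing (q ^ 2) (x ^ 2).
Proof.
intros H1 H2 n H. apply (Cmult_neq_0 _ _ (H1 n) (H2 n)).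
rewrite <- H, <- Cpow_mult_r. replace (2 * n)%nat with (n + n)%nat by lia.
rewrite Cpow_add_r. ring.
Qed.

Lemma qpoch_inf_square (q x : C) :
  (Cmod q < 1)%R ->
  qpoch_inf (q ^ 2) (x ^ 2) = qpoch_inf q x * qpoch_inf q (- x).
Proof.
intros Hq. apply (Clim_unique (qpoch (q ^ 2) (x ^ 2))).
- apply qpoch_lim, Cmod_pow_2_lt_1, Hq.
- eapply Clim_ext; [|apply Clim_mult; apply qpoch_lim, Hq].
  intros n. apply qpoch_square.
Qed.

(** Both series are limits of the two sides of [rogers_finite], by [phi_sums_lim] in base q^2 at x =
    0, where the weights tend to 1. *)
Lemma rogers_limit (q a p r : C) :
  (Cmod q < 1)%R -> qpoch_nonvanishing (q ^ 2) (- q ^ 2 * a) ->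
  Clim (csum (fun n => rpoch (q ^ 2) 0 1 n * (- q * a) ^ n / qpoch q q n)) p ->
  Clim (csum (fun k => rpoch (q ^ 2) 0 1 k * (- q * a) ^ k
     / (qpoch (q ^ 2) (q ^ 2) k * qpoch (q ^ 2) (- q ^ 2 * a) k))) r ->
  p = qpoch_inf (q ^ 2) (- q ^ 2 * a) * r.
Proof.
intros Hq Hx Hp Hr.
pose proof (qpoch_nonvanishing_small q q Hq Hq) as Hqq.
pose proof (Cmod_pow_2_lt_1 q Hq) as HQ.
pose proof (qpoch_nonvanishing_small _ _ HQ HQ) as HQQ.
pose proof (phi_sums_lim _ 0 _ p HQ Hp) as H1.
pose proof (Clim_mult _ _ _ _ (qpoch_lim _ (- q ^ 2 * a) HQ)
             (phi_sums_lim _ 0 _ r HQ Hr)) as H2.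
rewrite qpoch_inf_0 in H1, H2 by exact HQ.
transitivity (p * 1); [ring|].
transitivity (qpoch_inf (q ^ 2) (- q ^ 2 * a) * (r * 1)); [|ring].
apply (Clim_unique _ _ _ H1). revert H2. apply Clim_ext. intros N. cbv beta.
rewrite <- csum_scal.
transitivity (qpoch (q ^ 2) (q ^ 2) N *
  csum (fun n => rpoch (q ^ 2) 0 1 n * (- q * a) ^ n
                 / (qpoch q q n * qpoch (q ^ 2) (q ^ 2) (N - n))) (S N)).
- rewrite rogers_finite, <- csum_scal by assumption. apply csum_ext. intros k Hk.
  replace (qpoch (q ^ 2) (- q ^ 2 * a) N) with (qpoch (q ^ 2) (- q ^ 2 * a) k
     * qpoch (q ^ 2) (- q ^ 2 * a * (q ^ 2) ^ k) (N - k))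
    by (rewrite <- qpoch_add; f_equal; lia).
  rewrite qpoch_0.
  pose proof (qpoch_neq_0 _ _ k HQQ). pose proof (qpoch_neq_0 _ _ (N - k) HQQ).
  pose proof (qpoch_neq_0 _ _ k Hx).
  field. repeat split; assumption.
- rewrite <- csum_scal. apply csum_ext. intros k Hk. rewrite qpoch_0.
  pose proof (qpoch_neq_0 _ _ k Hqq). pose proof (qpoch_neq_0 _ _ (N - k) HQQ).
  field. split; assumption.
Qed.

(** The 2phi3 in the last identity is reached through this 0phi1, whose convergence must therefore
    be proved. The denominators are bounded below, and the ratio of consecutive numerators is q^(2n)
    q a, which tends to 0. *)
Lemma ex_series_phi_0_1_0 (q a : C) :
  (Cmod q < 1)%R -> q <> 0 -> a <> 0 -> ex_series (phi_term [] [RtoC 0] q (q * a)).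
Proof.
intros Hq q0 a0.
pose proof (qpoch_nonvanishing_small q q Hq Hq) as Hqq.
destruct (qpoch_ge q q Hq Hqq) as [c [Hc Hck]].
set (g := fun k => rpoch q 0 1 k * rpoch q 0 1 k * (q * a) ^ k).
assert (Hg : forall k, g k <> 0).
{ intros k. pose proof (rpoch_0_neq_0 q k q0).
  repeat apply Cmult_neq_0; try assumption. apply Cpow_nz, Cmult_neq_0; assumption. }
set (b := fun k => (Cmod (g k) / c)%R).
assert (Hb : forall k, (b k > 0)%R).
{ intros k. apply Rmult_lt_0_compat; [apply Cmod_gt_0, Hg|apply Rinv_0_lt_compat, Hc]. }
apply (ex_series_le (K := C_AbsRing) (V := C_CompleteNormedModule) _ (fun k => Rabs (b k))).
- intros k. rewrite Rabs_pos_eq by (left; apply Hb).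
  change (Cmod (phi_term [] [RtoC 0] q (q * a) k) <= b k)%R.
  replace (phi_term [] [RtoC 0] q (q * a) k) with (g k / qpoch q q k).
  + apply Cmod_bound_div; [exact Hc|apply Hck|apply Rle_refl].
  + unfold phi_term, qpochs, g. simpl. rewrite qpoch_0, qsign_rpoch.
    field. apply qpoch_neq_0, Hqq.
- apply ex_series_DAlembert with (k := 0%R); [lra| |].
  + intros n. specialize (Hb n). lra.
  + apply is_lim_seq_ext with
      (fun n => (Cmod (q ^ n) * Cmod (q ^ n) * Cmod (q * a))%R).
    * intros n. rewrite <- !Cmod_mult.
      replace (b (S n) / b n)%R with (Cmod (g (S n)) / Cmod (g n))%R.
      2:{ unfold b. field. split; [apply Rgt_not_eq; exact Hc|].
          apply Rgt_not_eq, Cmod_gt_0, Hg. }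
      rewrite <- Cmod_div by apply Hg. rewrite Rabs_pos_eq by apply Cmod_ge_0.
      f_equal. unfold g. simpl. field. split.
      -- apply Cpow_nz, Cmult_neq_0; assumption.
      -- apply rpoch_0_neq_0, q0.
    * replace (Finite 0) with (Finite (0 * 0 * Cmod (q * a))%R) by (f_equal; ring).
      apply is_lim_seq_mult'; [|apply is_lim_seq_const].
      apply is_lim_seq_mult'; apply Cpow_lim_0, Hq.
Qed.

(** * The theorem *)

Lemma Clim_CSeries_ext (u v : nat -> C) :
  (forall k, u k = v k) -> ex_series u -> Clim (csum v) (CSeries u).
Proof.
intros H Hu. apply (Clim_ext (csum u)); [|apply Clim_csum_CSeries, Hu].
intros n. apply csum_ext. intros k _. apply H.
Qed.

Lemma qpoch_inf_mult_0 (q x : C) : (Cmod q < 1)%R -> qpoch_inf q (x * 0) = 1.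
Proof.
intros Hq. replace (x * 0) with (RtoC 0) by ring. apply qpoch_inf_0, Hq.
Qed.

Lemma qpoch_mult_0 (q x : C) (k : nat) : qpoch q (x * 0) k = 1.
Proof. rewrite (qpoch_ext_arg q (x * 0) 0) by ring. apply qpoch_0. Qed.

Lemma Cdiv_mult (x y z : C) : y <> 0 -> z <> 0 -> x / (y * z) = x / y * / z.
Proof. intros. field. split; assumption. Qed.

(** * Matching of summands and prefactors *)

Ltac nonzero :=
  repeat split;
  first [ assumption
        | apply qpoch_neq_0; assumption
        | apply rpoch_0_neq_0; assumption
        | apply Cpow_nz; assumption
        | apply qpoch_inf_neq_0; assumption
        | repeat apply Cmult_neq_0; assumption ].

Ltac nonvanishing := first [assumption | apply nonvanishing_0].

Ltac split_denominators :=
  repeat match goal with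
  | |- context [qpoch _ (?x / (?y * ?z)) _] => rewrite (Cdiv_mult x y z) by nonzero
  | |- context [qpoch_inf _ (?x / (?y * ?z))] => rewrite (Cdiv_mult x y z) by nonzero
  end.

(** Brings both summands to a common form in reciprocal parameters: sign factors become
    [rpoch q 0 1 k], each (b;q)_k becomes b^k times an [rpoch], and powers are split so that [field]
    can compare them. *)
Ltac expand_terms :=
  unfold W_term, phi_term, W_limit_term, phi_limit_term, unit_alpha, qpochs;
  cbn [Cprod_list map fold_right length Nat.add];
  split_denominators;
  unfold Cdiv;
  rewrite ?qsign_rpoch, ?qpoch_mult_0, ?qpoch_0;
  repeat match goal with
  | h : ?b <> RtoC 0 |- context [qpoch ?q ?b ?k] =>
      (* The factor (q;q)_k is left as it stands, although q <> 0 is also in the context. *)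
      tryif constr_eq q b then fail else rewrite (qpoch_rpoch q b k h)
  end;
  rewrite ?Cpow_mult_l, ?Cpow_inv by nonzero;
  rewrite ?Cpow_mult_l, <- ?Cpow_mult_r;
  cbn [Nat.mul]; rewrite ?Nat.add_0_r, ?Cpow_add_r.

Ltac term_eq := let k := fresh "k" in intros k; expand_terms; field; nonzero.

Ltac by_watson q a B G D E hW hP :=
  eapply eq_trans;
  [ eapply (watson_limit q a B G D E);
    [ assumption | assumption
    | nonvanishing | nonvanishing | nonvanishing | nonvanishing
    | eapply Clim_CSeries_ext; [|exact hW]; term_eq
    | eapply Clim_CSeries_ext; [|exact hP]; term_eq ]
  | unfold qpochs_inf, phi; cbn [Cprod_list map fold_right];
    split_denominators; rewrite ?qpoch_inf_mult_0 by assumption; unfold Cdiv;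
    field; nonzero ].

Ltac by_watson_heine q a b G hW hP :=
  eapply eq_trans;
  [ eapply (watson_heine_limit q a b G);
    [ assumption | assumption | assumption
    | nonvanishing | nonvanishing
    | eapply Clim_CSeries_ext; [|exact hW]; term_eq
    | eapply Clim_CSeries_ext; [|exact hP]; term_eq ]
  | unfold qpochs_inf, phi; cbn [Cprod_list map fold_right];
    rewrite ?qpoch_inf_mult_0 by assumption; unfold Cdiv;
    field; nonzero ].

Theorem theorem2p1 (q a b c d e : C)
  (hq0 : (0 < Cmod q)%R) (hq1 : (Cmod q < 1)%R)
  (ha : a <> 0) (hb : b <> 0) (hc : c <> 0) (hd : d <> 0) (he : e <> 0)
  (ha1 : 1 - a <> 0) :
  (* (1) *)
  (List.Forall (qpoch_nonvanishing q) [q * a / b; q * a / c; q * a / d; q * a / e] ->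
   ex_series (W_term 1 a [b; c; d; e] q (q ^ 2 * a ^ 2 / (b * c * d * e))) ->
   ex_series (phi_term [q * a / (b * c); d; e] [q * a / b; q * a / c]
                q (q * a / (d * e))) ->
   W 1 a [b; c; d; e] q (q ^ 2 * a ^ 2 / (b * c * d * e))
   = qpochs_inf q [q * a; q * a / (d * e)] / qpochs_inf q [q * a / d; q * a / e]
     * phi [q * a / (b * c); d; e] [q * a / b; q * a / c] q (q * a / (d * e)))
  /\
  (* (2) *)
  (List.Forall (qpoch_nonvanishing q) [q * a / b; q * a / c; q * a / d] ->
   ex_series (W_term 2 a [b; c; d] q (q ^ 2 * a ^ 2 / (b * c * d))) ->
   (ex_series (phi_term [q * a / (b * c); d] [q * a / b; q * a / c]
                 q (q * a / d)) ->
    W 2 a [b; c; d] q (q ^ 2 * a ^ 2 / (b * c * d))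
    = qpochs_inf q [q * a] / qpochs_inf q [q * a / d]
      * phi [q * a / (b * c); d] [q * a / b; q * a / c] q (q * a / d))
   /\
   (ex_series (phi_term [b; d] [q * a / c] q (q * a / (b * d))) ->
    W 2 a [b; c; d] q (q ^ 2 * a ^ 2 / (b * c * d))
    = qpochs_inf q [q * a; q * a / (b * d)] / qpochs_inf q [q * a / b; q * a / d]
      * phi [b; d] [q * a / c] q (q * a / (b * d))))
  /\
  (* (3) *)
  (List.Forall (qpoch_nonvanishing q) [q * a / b; q * a / c] ->
   ex_series (W_term 3 a [b; c] q (q ^ 2 * a ^ 2 / (b * c))) ->
   (ex_series (phi_term [q * a / (b * c)] [q * a / b; q * a / c] q (q * a)) ->
    W 3 a [b; c] q (q ^ 2 * a ^ 2 / (b * c))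
    = qpochs_inf q [q * a]
      * phi [q * a / (b * c)] [q * a / b; q * a / c] q (q * a))
   /\
   (ex_series (phi_term [b] [q * a / c] q (q * a / b)) ->
    W 3 a [b; c] q (q ^ 2 * a ^ 2 / (b * c))
    = qpochs_inf q [q * a] / qpochs_inf q [q * a / b]
      * phi [b] [q * a / c] q (q * a / b))
   /\
   (ex_series (phi_term [b; c] [RtoC 0] q (q * a / (b * c))) ->
    W 3 a [b; c] q (q ^ 2 * a ^ 2 / (b * c))
    = qpochs_inf q [q * a; q * a / (b * c)] / qpochs_inf q [q * a / b; q * a / c]
      * phi [b; c] [RtoC 0] q (q * a / (b * c)))
   /\
   (ex_series (phi_term [q * a / (b * c); RtoC 0] [q * a / b] q b) ->
    W 3 a [b; c] q (q ^ 2 * a ^ 2 / (b * c))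
    = qpochs_inf q [q * a; b] / qpochs_inf q [q * a / c]
      * phi [q * a / (b * c); RtoC 0] [q * a / b] q b))
  /\
  (* (4) *)
  (List.Forall (qpoch_nonvanishing q) [q * a / b] ->
   ex_series (W_term 4 a [b] q (q ^ 2 * a ^ 2 / b)) ->
   (ex_series (phi_term [] [q * a / b] q (q * a)) ->
    W 4 a [b] q (q ^ 2 * a ^ 2 / b)
    = qpochs_inf q [q * a] * phi [] [q * a / b] q (q * a))
   /\
   (ex_series (phi_term [b] [RtoC 0] q (q * a / b)) ->
    W 4 a [b] q (q ^ 2 * a ^ 2 / b)
    = qpochs_inf q [q * a] / qpochs_inf q [q * a / b]
      * phi [b] [RtoC 0] q (q * a / b))
   /\
   (ex_series (phi_term [RtoC 0; RtoC 0] [q * a / b] q b) ->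
    W 4 a [b] q (q ^ 2 * a ^ 2 / b)
    = qpochs_inf q [q * a; b] * phi [RtoC 0; RtoC 0] [q * a / b] q b))
  /\
  (* (5) *)
  (ex_series (W_term 5 a [] q (q ^ 2 * a ^ 2)) ->
   (ex_series (phi_term [] [RtoC 0] q (q * a)) ->
    W 5 a [] q (q ^ 2 * a ^ 2)
    = qpochs_inf q [q * a] * phi [] [RtoC 0] q (q * a))
   /\
   (* s is either square root of a *)
   (forall s : C, s ^ 2 = a ->
    List.Forall (qpoch_nonvanishing q) [- q; Ci * q * s; - (Ci * q * s)] ->
    ex_series (phi_term [RtoC 0; RtoC 0] [- q; Ci * q * s; - (Ci * q * s)]
                 q (q * a)) ->
    W 5 a [] q (q ^ 2 * a ^ 2)
    = qpochs_inf q [q * a; Ci * q * s; - (Ci * q * s)]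
      * phi [RtoC 0; RtoC 0] [- q; Ci * q * s; - (Ci * q * s)] q (q * a))).

Proof.
assert (q0 : q <> 0) by (apply Cmod_gt_0; exact hq0).
pose proof (qpoch_nonvanishing_small q q hq1 hq1) as Hqq.
split; [|split; [|split; [|split]]].
- intros HF hW hP. rewrite !Forall_cons_iff in HF.
  destruct HF as (HB & HC & HD & HE & _).
  by_watson q a (/ b) (/ c) (/ d) (/ e) hW hP.
- intros HF hW. rewrite !Forall_cons_iff in HF. destruct HF as (HB & HC & HD & _).
  split; intros hP.
  (* The very-well-poised side is symmetric in the four reciprocals, the other side only within each
     pair; the different pairings produce the different right-hand sides. *)
  + by_watson q a (/ b) (/ c) (/ d) (RtoC 0) hW hP.
  + by_watson q a (/ c) (RtoC 0) (/ b) (/ d) hW hP.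
- intros HF hW. rewrite !Forall_cons_iff in HF. destruct HF as (HB & HC & _).
  split; [|split; [|split]]; intros hP.
  + by_watson q a (/ b) (/ c) (RtoC 0) (RtoC 0) hW hP.
  + by_watson q a (/ c) (RtoC 0) (/ b) (RtoC 0) hW hP.
  + by_watson q a (RtoC 0) (RtoC 0) (/ b) (/ c) hW hP.
  + by_watson_heine q a b (/ c) hW hP.
- intros HF hW. rewrite !Forall_cons_iff in HF. destruct HF as (HB & _).
  split; [|split]; intros hP.
  + by_watson q a (/ b) (RtoC 0) (RtoC 0) (RtoC 0) hW hP.
  + by_watson q a (RtoC 0) (RtoC 0) (/ b) (RtoC 0) hW hP.
  + by_watson_heine q a b (RtoC 0) hW hP.
- intros hW.
  assert (H5 : ex_series (phi_term [] [RtoC 0] q (q * a)) ->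
    W 5 a [] q (q ^ 2 * a ^ 2) = qpochs_inf q [q * a] * phi [] [RtoC 0] q (q * a)).
  { intros hP. by_watson q a (RtoC 0) (RtoC 0) (RtoC 0) (RtoC 0) hW hP. }
  split; [exact H5|].
  intros s hs HF hP. rewrite !Forall_cons_iff in HF. destruct HF as (H1 & H2 & H3 & _).
  (* The 0phi1 evaluation is available here, and Rogers' identity then turns the 0phi1 into the
     2phi3. *)
  pose proof (ex_series_phi_0_1_0 q a hq1 q0 ha) as h5. rewrite (H5 h5).
  (* Hence (-q^2 a;q^2)_k splits into the factors of base q with the parameters x and -x, for x = i
     q s. *)
  assert (Es : (Ci * q * s) ^ 2 = - q ^ 2 * a).
  { rewrite <- hs. transitivity (Ci * Ci * q ^ 2 * s ^ 2); [ring|].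
    replace (Ci * Ci) with (- (1)) by (unfold Ci, Cmult, Copp; simpl; f_equal; ring).
    ring. }
  set (x := Ci * q * s) in *.
  assert (Hx : qpoch_nonvanishing (q ^ 2) (- q ^ 2 * a)).
  { rewrite <- Es. apply nonvanishing_square; assumption. }
  assert (Ei : qpoch_inf (q ^ 2) (- q ^ 2 * a) = qpoch_inf q x * qpoch_inf q (- x)).
  { rewrite <- Es. apply qpoch_inf_square, hq1. }
  assert (Ea : forall k, (- q * a) ^ k = (- (1)) ^ k * (q * a) ^ k).
  { intros k. rewrite <- Cpow_mult_l. f_equal. ring. }
  unfold qpochs_inf, phi; cbn [Cprod_list map fold_right].
  rewrite (rogers_limit q a (CSeries (phi_term [] [RtoC 0] q (q * a)))
    (CSeries (phi_term [RtoC 0; RtoC 0] [- q; x; - x] q (q * a))) hq1 Hx).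
  + rewrite Ei. ring.
  + eapply Clim_CSeries_ext; [|exact h5]. intros k.
    rewrite Ea. unfold phi_term, qpochs. cbn [Cprod_list map fold_right length Nat.add].
    rewrite qsign_rpoch, qpoch_0.
    transitivity (rpoch q 0 1 k * rpoch q 0 1 k * (q * a) ^ k / qpoch q q k).
    * field. nonzero.
    * rewrite <- rpoch_0_square. field. nonzero.
  + eapply Clim_CSeries_ext; [|exact hP]. intros k.
    (* The factor (q^2;q^2)_k splits as well, into (q;q)_k (-q;q)_k, which explains the parameter -q
       of the 2phi3. *)
    rewrite Ea, <- Es, <- !qpoch_square. unfold phi_term, qpochs.
    cbn [Cprod_list map fold_right length Nat.add]. rewrite qsign_rpoch, qpoch_0.
    transitivity (rpoch q 0 1 k * rpoch q 0 1 k * (q * a) ^ k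
      / (qpoch q q k * qpoch q (- q) k * (qpoch q x k * qpoch q (- x) k))).
    * field. nonzero.
    * rewrite <- rpoch_0_square. field. nonzero.
Qed.
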